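(* Let $(S,0)$ be an analytically irreducible quasi-ordinary hypersurface germ of dimension $d=2$ with characteristic exponents $\lambda_1\prec\cdots\prec\lambda_g$ and associated semigroup $\Gamma$, and consider an overweight deformation $H_1,\dots,H_g$ of the binomials $h_1,\dots,h_g$ defining $Z^\Gamma$, with fibers $(S_p,0)\subset(\mathbb{C}^{2+g},0)$. Then the equality $$\mathrm{Jac}(S_p)\,\mathcal{O}_Z = X^{\gamma_0}\,\mathcal{J}_{\mathrm{log}}(S_p)$$ holds for any point $p$ in the torus of $Z^\Gamma$.
   Context: The definitions below are given for arbitrary $d\ge1$; the claim concerns $d=2$. Quasi-ordinary data. Let $X=(X_1,\dots,X_d)$. A Weierstrass polynomial $f\in\mathbb{C}\{X\}[Y]$ is quasi-ordinary if its discriminant with respect to $Y$ is $X^\delta\epsilon$ with $\delta\in\mathbb{Z}_{\ge0}^d$ and $\epsilon$ a unit of $\mathbb{C}\{X\}$. Let $f$ be irreducible quasi-ordinary of degree $n$, defining $(S,0)\subset(\mathbb{C}^{d+1},0)$. Its roots lie in $\mathbb{C}\{X_1^{1/n},\dots,X_d^{1/n}\}$ (Jung-Abhyankar) and are called quasi-ordinary branches; they parametrize $S$. The difference of two distinct roots is $X^{\lambda}$ times a unit; the exponents $\lambda\in\frac1n\mathbb{Z}_{\ge0}^d$ so obtained are the characteristic exponents, and (Lipman) they can be labelled $\lambda_1\prec\cdots\prec\lambda_g$, where $\gamma\prec\gamma'$ means $\gamma'-\gamma\in\mathbb{R}^d_{\ge0}$ and $\gamma\ne\gamma'$. Let $e_1,\dots,e_d$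 be the canonical basis of $M_0=\mathbb{Z}^d$, $M_j=M_{j-1}+\mathbb{Z}\lambda_j$, $M=M_g$, $n_j=[M_j:M_{j-1}]$, $\sigma^\vee=\mathbb{R}^d_{\ge0}$. Put $\overline\lambda_1=\lambda_1$, $\overline\lambda_{j+1}=n_j\overline\lambda_j+\lambda_{j+1}-\lambda_j$. $\Gamma\subset\sigma^\vee\cap M$ is the semigroup generated by $\gamma_1,\dots,\gamma_{d+g}:=e_1,\dots,e_d,\overline\lambda_1,\dots,\overline\lambda_g$. There are uniquely determined relations $n_j\overline\lambda_j=\sum_{i=1}^{d}\ell_i^{(j)}e_i+\sum_{k=1}^{j-1}\ell_{d+k}^{(j)}\overline\lambda_k$ with $\ell_i^{(j)}\in\mathbb{Z}_{\ge0}$ for $i\le d$ and $0\le \ell_{d+k}^{(j)}<n_k$, $j=1,\dots,g$. Put $\gamma_0=\sum_{j=1}^g(n_j-1)\overline\lambda_j-\sum_{i=1}^d e_i$ (the minimal Frobenius vector of $\Gamma$). Deformation. Let $h_j=U_1^{\ell_1^{(j)}}\cdots U_{d+j-1}^{\ell_{d+j-1}^{(j)}}-U_{d+j}^{n_j}$, $j=1,\dots,g$; these generate the ideal of $Z^\Gamma=\mathrm{Spec}\,\mathbb{C}[\Gamma]\subset\mathbb{C}^{d+g}$, $U_i=X^{\gamma_i}$. Let $\psi:\mathbb{Z}^{d+g}\to M$ send the $i$th canonical vector to $\gamma_i$. An overweight deformation is a family $$H_j=h_j+c_j\,t^{\overline\lambda_{j+1}-n_j\overline\lambda_j}U_{d+j+1}+\sum_{n_j\overline\lambda_j\prec\psi(\alpha^{(j)})}c_{\alpha^{(j)}}\,t^{\psi(\alpha^{(j)})-n_j\overline\lambda_j}\,U_1^{\alpha_1^{(j)}}\cdots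 U_{d+j}^{\alpha_{d+j}^{(j)}},\quad j=1,\dots,g,$$ with $\alpha^{(j)}\in\mathbb{Z}_{\ge0}^{d+j}$ (viewed in $\mathbb{Z}^{d+g}$), $c_{\alpha^{(j)}}\in\mathbb{C}$, $c_j\in\mathbb{C}^*$ for $j<g$, and $c_g=0$. A point $p$ of the torus of $Z^\Gamma$ is a group homomorphism $M\to\mathbb{C}^*$, $m\mapsto t^m(p)$; $H_{j,p}$ is obtained by replacing each $t^m$ by $t^m(p)$ and is assumed convergent. $S_p$ is the germ at $0$ of $H_{1,p}=\dots=H_{g,p}=0$. For $p$ in the torus, eliminating $U_{d+g},\dots,U_{d+2}$ embeds $S_p$ as an irreducible quasi-ordinary hypersurface in $(\mathbb{C}^{d+1},0)$ with coordinates $(U_1,\dots,U_{d+1})$, parametrized by a quasi-ordinary branch $U_{d+1}=\zeta_p(X)$, $U_i=X_i$ $(i\le d)$, with characteristic exponents $\lambda_1,\dots,\lambda_g$; the integral closure of $\mathcal{O}_{S_p}$ is $\mathcal{O}_Z=\mathbb{C}\{\sigma^\vee\cap M\}$, the ring of convergent power series in $X$ with exponents in $\sigma^\vee\cap M$, via $U_i\mapsto X^{e_i}$ $(i\le d)$, $U_{d+1}\mapsto\zeta_p$. $\mathrm{Jac}(S_p)\subset\mathcal{O}_{S_p}$ is the ideal generated by the $g\times g$ minors of $(\partial H_{j,p}/\partial U_i)$, and $\mathrm{Jac}(S_p)\mathcal{O}_Z$ is its extension. Logarithmic Jacobian ideal. For an analytically irreducible germ $W$ of dimension $d$ whose normalization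 is $Z$ (local ring $\mathcal{O}_Z=\mathbb{C}\{\sigma^\vee\cap M\}$), let $\Omega^1_W$ be the module of (analytic) Kähler differentials and $\Omega^d_W=\bigwedge^d\Omega_W^1$. Let $\eta:\Omega^1_Z\to\mathcal{O}_Z\otimes_{\mathbb{Z}}M$ be the $\mathcal{O}_Z$-linear map with $d(\sum c_\gamma X^\gamma)\mapsto\sum c_\gamma X^\gamma\otimes\gamma$. With $\bigwedge^dM\cong\mathbb{Z}$ (choice of a basis of $M$), $\mathcal{J}_{\mathrm{log}}(W)$ is the ideal of $\mathcal{O}_Z$ generated by the image of $\Omega^d_W\to\Omega^d_Z\xrightarrow{\wedge^d\eta}\mathcal{O}_Z\otimes\bigwedge^dM\cong\mathcal{O}_Z$. The product of $X^{\gamma_0}$ with an ideal is taken in the fraction field of $\mathcal{O}_Z$. *)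

(* Defs.v *)
From HB Require Import structures.
From mathcomp Require Import all_boot all_order all_algebra.
From mathcomp Require Import boolp classical_sets cardinality reals.
From mathcomp Require Import finmap complex freeg mpoly.

Set Implicit Arguments.
Unset Strict Implicit.
Unset Printing Implicit Defensive.

Import Order.TTheory GRing.Theory Num.Theory.

Local Open Scope quotient_scope.
Local Open Scope classical_set_scope.
Local Open Scope ring_scope.

(* Absolute convergence on some polydisc of radius r > 0: the finite partial
   sums of the |f a| r^|a| are bounded. *)
Definition convergent (R : realType) (k : nat) (f : 'X_{1..k} -> R[i]) : Prop :=
  exists2 r : R[i], 0 < r &
  exists K : R[i], forall D : nat,
    \sum_(a : 'X_{1..k < D}) `|f a| * r ^+ mdeg a <= K.

Record cvps (R : realType) (k : nat) := Cvps {
  coefs :> 'X_{1..k} -> R[i];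
  cvpsP : convergent coefs }.

Section Convergence.
Context (R : realType) (k : nat).
Local Notation C := (R[i]).
Implicit Types (f g : 'X_{1..k} -> C).

Lemma sum_seq_le (F : 'X_{1..k} -> C) (K : C) :
  (forall a, 0 <= F a) -> (forall D, \sum_(a : 'X_{1..k < D}) F a <= K) ->
  forall s : seq 'X_{1..k}, uniq s -> \sum_(a <- s) F a <= K.
Proof.
move=> F0 FK s us; pose D := (\max_(a <- s) mdeg a).+1.
apply: le_trans (FK D).
pose t := [seq bmnm a | a <- index_enum 'X_{1..k < D}].
have -> : \sum_(a : 'X_{1..k < D}) F a = \sum_(a <- t) F a by rewrite big_map.
have ut : uniq t.
  by rewrite map_inj_uniq ?index_enum_uniq // => x y /val_inj.
have st : {subset s <= t}.
  move=> a sa; have aD : (mdeg a < D)%N.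
    by rewrite /D ltnS (big_rem a) //= leq_maxl.
  by apply/mapP; exists (BMultinom aD); rewrite ?mem_index_enum.
have pst : perm_eq t (s ++ [seq a <- t | a \notin s]).
  apply: uniq_perm => //.
    rewrite cat_uniq us filter_uniq // andbT /=; apply/hasPn => x.
    by rewrite mem_filter => /andP[].
  move=> x; rewrite mem_cat mem_filter; case: (boolP (x \in s)) => //= sx.
  by rewrite st.
by rewrite (perm_big _ pst) big_cat /= lerDl sumr_ge0.
Qed.

Lemma convergent_le f (r r' : C) (K : C) : 0 < r' -> r' <= r ->
  (forall D, \sum_(a : 'X_{1..k < D}) `|f a| * r ^+ mdeg a <= K) ->
  forall D, \sum_(a : 'X_{1..k < D}) `|f a| * r' ^+ mdeg a <= K.
Proof.
move=> r'0 r'r fK D; apply: le_trans (fK D); apply: ler_sum => a _.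
by rewrite ler_wpM2l ?normr_ge0 // lerXn2r ?nnegrE ?(ltW r'0) ?(ltW (lt_le_trans r'0 r'r)).
Qed.

Lemma posC_min (r r' : C) : 0 < r -> 0 < r' ->
  exists2 s : C, 0 < s & (s <= r) && (s <= r').
Proof.
move=> r0 r'0; have : r >=< r' by apply: real_comparable; apply: gtr0_real.
by case/orP => h; [exists r|exists r'] => //; rewrite lexx h.
Qed.

Lemma convergent0 : convergent (fun _ : 'X_{1..k} => 0 : C).
Proof.
by exists 1 => //; exists 0 => D; rewrite big1 // => a _; rewrite normr0 mul0r.
Qed.

Lemma convergentD f g : convergent f -> convergent g ->
  convergent (fun a => f a + g a).
Proof.
case=> r r0 [K fK] [r' r'0 [K' gK]].
have [s s0 /andP[sr sr']] := posC_min r0 r'0; exists s => //; exists (K + K').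
move=> D; apply: le_trans (lerD (convergent_le s0 sr fK D)
                                (convergent_le s0 sr' gK D)).
rewrite -big_split /=; apply: ler_sum => a _.
by rewrite -mulrDl ler_wpM2r ?exprn_ge0 ?(ltW s0) // ler_normD.
Qed.

Lemma convergentZ (c : C) f : convergent f -> convergent (fun a => c * f a).
Proof.
case=> r r0 [K fK]; exists r => //; exists (`|c| * K) => D.
apply: le_trans (ler_wpM2l (normr_ge0 c) (fK D)).
by rewrite mulr_sumr; apply: ler_sum => a _; rewrite normrM mulrA.
Qed.

Lemma convergentN f : convergent f -> convergent (fun a => - f a).
Proof.
case=> r r0 [K fK]; exists r => //; exists K => D.
by apply: le_trans (fK D); apply: ler_sum => a _; rewrite normrN.
Qed.

Lemma convergent_mon (m : 'X_{1..k}) : convergent (fun a => (a == m)%:R : C).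
Proof.
exists 1 => //; exists 1 => D.
have [mD|mD] := ltnP (mdeg m) D.
  rewrite (bigD1 (BMultinom mD)) //= eqxx normr1 expr1n mulr1 big1 ?addr0 // => a.
  by rewrite bmeqP /= => /negbTE->; rewrite normr0 mul0r.
rewrite big1 // => a _; case: eqP => [am|]; last by rewrite normr0 mul0r.
by move: (bmdeg a); rewrite am ltnNge mD.
Qed.

Definition trunc D (f : 'X_{1..k} -> C) : {mpoly C[k]} :=
  \sum_(m : 'X_{1..k < D}) f m *: 'X_[m].

Lemma truncE D (f : 'X_{1..k} -> C) (a : 'X_{1..k}) :
  (mdeg a < D)%N -> (trunc D f)@_a = f a.
Proof. exact: mcoeff_mpoly. Qed.

Lemma mcoeffM_lin D (p q : {mpoly C[k]}) (a : 'X_{1..k}) : (mdeg a < D)%N ->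
  (p * q)@_a = \sum_(b : 'X_{1..k < D} | (b <= a)%MM) p@_b * q@_(a - b)%MM.
Proof. exact: mcoeff_poly_mul_lin. Qed.

Lemma mdeg_le (a b : 'X_{1..k}) : (a <= b)%MM -> (mdeg a <= mdeg b)%N.
Proof. by move=> ab; rewrite !mdegE; apply: leq_sum => i _; exact: (mnm_lepP ab). Qed.

Definition mulc f g (a : 'X_{1..k}) : C :=
  \sum_(b : 'X_{1..k < (mdeg a).+1} | (b <= a)%MM) f b * g (a - b)%MM.

Lemma mulc_widen f g (a : 'X_{1..k}) D : (mdeg a < D)%N ->
  mulc f g a = \sum_(b : 'X_{1..k < D} | (b <= a)%MM) f b * g (a - b)%MM.
Proof.
move=> aD; transitivity ((trunc D f * trunc D g)@_a).
  rewrite [RHS](mcoeffM_lin _ _ (ltnSn (mdeg a))).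
  apply: eq_bigr => b ba; rewrite !truncE //.
    exact: leq_ltn_trans (mdegB _ _) aD.
  exact: leq_ltn_trans (mdeg_le ba) aD.
rewrite [LHS](mcoeffM_lin _ _ aD).
apply: eq_bigr => b ba; rewrite !truncE ?bmdeg //.
exact: leq_ltn_trans (mdegB _ _) aD.
Qed.

Lemma convergentM f g : convergent f -> convergent g -> convergent (mulc f g).
Proof.
case=> r0 r00 [K fK] [r' r'0 [K' gK]].
have [r r0' /andP[sr sr']] := posC_min r00 r'0.
have {}fK := convergent_le r0' sr fK; have {}gK := convergent_le r0' sr' gK.
exists r => //; exists (K * K') => D.
pose F (h : 'X_{1..k} -> C) (a : 'X_{1..k}) := `|h a| * r ^+ mdeg a.
have F0 h a : 0 <= F h a by rewrite mulr_ge0 // exprn_ge0 // ltW.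
have K'0 : 0 <= K' by apply: le_trans (gK 0%N); apply: sumr_ge0 => a _; exact: F0.
have gS := sum_seq_le (F0 g) gK.
apply: (@le_trans _ _ (\sum_(a : 'X_{1..k < D})
          \sum_(b : 'X_{1..k < D} | (b <= a)%MM) F f b * F g (a - b)%MM)).
  apply: ler_sum => a _; rewrite (mulc_widen _ _ (bmdeg a)).
  rewrite (@le_trans _ _ ((\sum_(b : 'X_{1..k < D} | (b <= a)%MM)
     `|f b * g (a - b)%MM|) * r ^+ mdeg a)) //.
    by rewrite ler_wpM2r ?exprn_ge0 ?(ltW r0') // ler_norm_sum.
  rewrite mulr_suml; apply: ler_sum => b ba; rewrite /F mulrACA -exprD -mdegD.
  by rewrite [(b + _)%MM]addmC submK // normrM.
rewrite (exchange_big_dep xpredT) //=.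
apply: (@le_trans _ _ (\sum_(b : 'X_{1..k < D}) F f b * K')); last first.
  by rewrite -mulr_suml ler_wpM2r.
apply: ler_sum => b _; rewrite -mulr_sumr ler_wpM2l //.
pose s := [seq (bmnm a - b)%MM | a <- index_enum 'X_{1..k < D} & (b <= bmnm a)%MM].
have := gS s; rewrite big_map big_filter; apply.
rewrite map_inj_in_uniq ?filter_uniq ?index_enum_uniq // => x y.
rewrite !mem_filter => /andP[bx _] /andP[b_y _] /(congr1 (fun m => m + b)%MM).
by rewrite !submK // => /val_inj.
Qed.

Lemma convergent_weight (w : 'X_{1..k} -> C) (c : C) f :
  (forall a, `|w a| <= c * 2 ^+ mdeg a) -> convergent f ->
  convergent (fun a => w a * f a).
Proof.
move=> wc [r r0 [K fK]]; exists (r / 2); first by rewrite divr_gt0.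
have c0 : 0 <= c.
  by have := le_trans (normr_ge0 _) (wc 0%MM); rewrite mdeg0 expr0 mulr1.
exists (c * K) => D; apply: le_trans (ler_wpM2l c0 (fK D)).
rewrite mulr_sumr; apply: ler_sum => a _.
have -> : c * (`|f a| * r ^+ mdeg a)
        = (c * 2 ^+ mdeg a) * (`|f a| * (r / 2) ^+ mdeg a).
  have n20 : (2 : C) != 0 by rewrite pnatr_eq0.
  have rE : r = r / 2 * 2 by rewrite divfK.
  by rewrite [in LHS]rE exprMn [X in _ * (_ * X)]mulrC (mulrCA `|f a|) !mulrA.
rewrite normrM -[leLHS]mulrA; apply: ler_wpM2r (wc a).
by rewrite mulr_ge0 ?normr_ge0 // exprn_ge0 // divr_ge0 // ltW.
Qed.

Lemma le_expn2 n : (n.+1%:R <= 2 ^+ n :> C).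
Proof. by rewrite -natrX ler_nat ltn_expl. Qed.

Lemma mnm_le_mdeg (a : 'X_{1..k}) i : (a i <= mdeg a)%N.
Proof. by rewrite mdegE (bigD1 i) //= leq_addr. Qed.

Lemma convergent_pderiv (i : 'I_k) f : convergent f ->
  convergent (fun a => (a i).+1%:R * f (a + U_(i))%MM).
Proof.
move=> cf; apply: (@convergent_weight _ 1).
  move=> a; rewrite mul1r ger0_norm ?ler0n //.
  by apply: le_trans (le_expn2 _); rewrite ler_nat ltnS mnm_le_mdeg.
case: cf => r r0 [K fK]; exists r => //; exists (K / r) => D.
rewrite ler_pdivlMr // mulr_suml.
pose F (a : 'X_{1..k}) := `|f a| * r ^+ mdeg a.
have F0 a : 0 <= F a by rewrite mulr_ge0 // exprn_ge0 // ltW.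
pose s := [seq (bmnm a + U_(i))%MM | a <- index_enum 'X_{1..k < D}].
have := sum_seq_le F0 fK (s := s); rewrite big_map => h.
rewrite (le_trans _ (h _)) //.
  by apply: ler_sum => a _; rewrite /F mdegD mdeg1 addn1 exprSr mulrA.
rewrite map_inj_uniq ?index_enum_uniq // => x y /addIm /val_inj //.
Qed.

Definition divm n (a : 'X_{1..k}) : 'X_{1..k} := [multinom (a i %/ n)%N | i < k].

Definition ramify_coefs n f (a : 'X_{1..k}) : C :=
  if [forall i, (n %| a i)%N] then f (divm n a) else 0.

Lemma convergent_ramify n f : convergent f -> convergent (ramify_coefs n f).
Proof.
case=> r r0 [K fK]; have [s s0 /andP[sr s1]] := posC_min r0 ltr01.
exists s => //; exists K => D.
pose F (a : 'X_{1..k}) := `|f a| * r ^+ mdeg a.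
have F0 a : 0 <= F a by rewrite mulr_ge0 // exprn_ge0 // ltW.
pose P (a : 'X_{1..k}) := [forall i, (n %| a i)%N].
pose t := [seq divm n (bmnm a) | a <- index_enum 'X_{1..k < D} & P (bmnm a)].
have := sum_seq_le F0 fK (s := t); rewrite big_map big_filter => h.
rewrite (le_trans _ (h _)) //; last first.
  rewrite map_inj_in_uniq ?filter_uniq ?index_enum_uniq // => x y.
  rewrite !mem_filter => /andP[/forallP nx _] /andP[/forallP ny _] /mnmP xy.
  apply/val_inj/mnmP => i; have := xy i; rewrite !mnmE => e.
  by rewrite -(divnK (nx i)) e divnK.
rewrite [leRHS]big_mkcond /=; apply: ler_sum => a _; rewrite /ramify_coefs -/(P a).
case: (P a); last by rewrite normr0 mul0r.
rewrite ler_wpM2l ?normr_ge0 //.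
apply: (@le_trans _ _ (s ^+ mdeg (divm n a))).
  apply: ler_wiXn2l => //; first exact: ltW.
  rewrite !mdegE; apply: leq_sum => i _; rewrite mnmE; exact: leq_div.
by rewrite lerXn2r ?nnegrE ?(ltW s0) ?(ltW r0).
Qed.

End Convergence.

Section Ring.
Context (R : realType) (k : nat).
Local Notation C := (R[i]).
Local Notation P := (cvps R k).
Implicit Types (f g h : P).

HB.instance Definition _ := gen_eqMixin P.
HB.instance Definition _ := gen_choiceMixin P.

Lemma cvps_eqP f g : coefs f =1 coefs g <-> f = g.
Proof.
split=> [|->//]; case: f g => [f cf] [g cg] /= /funext fg.
by subst g; congr Cvps; exact: Prop_irrelevance.
Qed.

Definition cv0 : P := Cvps (@convergent0 R k).
Definition cvadd f g : P := Cvps (convergentD (cvpsP f) (cvpsP g)).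
Definition cvopp f : P := Cvps (convergentN (cvpsP f)).
Definition mon (a : 'X_{1..k}) : P := Cvps (@convergent_mon R k a).
Definition cvmul f g : P := Cvps (convergentM (cvpsP f) (cvpsP g)).
Definition cvscale (c : C) f : P := Cvps (convergentZ c (cvpsP f)).

Fact cvaddA : associative cvadd.
Proof. by move=> f g h; apply/cvps_eqP => a; exact: addrA. Qed.
Fact cvaddC : commutative cvadd.
Proof. by move=> f g; apply/cvps_eqP => a; exact: addrC. Qed.
Fact cvadd0 : left_id cv0 cvadd.
Proof. by move=> f; apply/cvps_eqP => a; exact: add0r. Qed.
Fact cvaddN : left_inverse cv0 cvopp cvadd.
Proof. by move=> f; apply/cvps_eqP => a; exact: addNr. Qed.

HB.instance Definition _ := GRing.isZmodule.Build P cvaddA cvaddC cvadd0 cvaddN.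

Lemma cvmul_trunc f g D (a : 'X_{1..k}) : (mdeg a < D)%N ->
  cvmul f g a = (trunc D f * trunc D g)@_a.
Proof.
move=> aD; rewrite [RHS](mcoeffM_lin _ _ (ltnSn (mdeg a))).
apply: eq_bigr => b ba; rewrite !truncE //.
  exact: leq_ltn_trans (mdegB _ _) aD.
exact: leq_ltn_trans (mdeg_le ba) aD.
Qed.

Lemma mcoeffM_eq (p p' q q' : {mpoly C[k]}) (a : 'X_{1..k}) :
  (forall b : 'X_{1..k}, (mdeg b <= mdeg a)%N -> p@_b = p'@_b) ->
  (forall b : 'X_{1..k}, (mdeg b <= mdeg a)%N -> q@_b = q'@_b) ->
  (p * q)@_a = (p' * q')@_a.
Proof.
move=> pp qq; rewrite [LHS](mcoeffM_lin _ _ (ltnSn (mdeg a))).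
rewrite [RHS](mcoeffM_lin _ _ (ltnSn (mdeg a))).
by apply: eq_bigr => b ba; rewrite pp ?(mdeg_le ba) // qq ?mdegB.
Qed.

Fact cvmulA : associative cvmul.
Proof.
move=> f g h; apply/cvps_eqP => a; set D := (mdeg a).+1.
rewrite !(@cvmul_trunc _ _ D) //.
rewrite (@mcoeffM_eq _ (trunc D f) _ (trunc D g * trunc D h)) //; last first.
  by move=> b ba; rewrite truncE ?ltnS // (@cvmul_trunc _ _ D) ?ltnS.
rewrite mulrA; apply: mcoeffM_eq => // b ba.
by rewrite [RHS]truncE ?ltnS // (@cvmul_trunc _ _ D) ?ltnS.
Qed.
Fact cvmulC : commutative cvmul.
Proof.
move=> f g; apply/cvps_eqP => a.
by rewrite !(@cvmul_trunc _ _ (mdeg a).+1) // mulrC.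
Qed.
Fact cvmul1 : left_id (mon 0%MM) cvmul.
Proof.
move=> f; apply/cvps_eqP => a; rewrite (@cvmul_trunc _ _ (mdeg a).+1) //.
rewrite -[RHS](truncE _ (ltnSn (mdeg a))) -[in RHS](mul1r (trunc _ f)).
by apply: mcoeffM_eq => // b ba; rewrite truncE ?ltnS //= mcoeff1.
Qed.
Fact cvmulD : left_distributive cvmul +%R.
Proof.
move=> f g h; apply/cvps_eqP => a; rewrite /= /mulc -big_split /=.
by apply: eq_bigr => b _; rewrite mulrDl.
Qed.
Fact mon0_neq0 : mon 0%MM != 0.
Proof.
by apply/eqP => /cvps_eqP /(_ 0%MM)/eqP; rewrite /= eqxx oner_eq0.
Qed.

HB.instance Definition _ :=
  GRing.Zmodule_isComNzRing.Build P cvmulA cvmulC cvmul1 cvmulD mon0_neq0.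

Fact cvscaleA (a b : C) f : cvscale a (cvscale b f) = cvscale (a * b) f.
Proof. by apply/cvps_eqP => m; exact: mulrA. Qed.
Fact cvscale1 : left_id 1 cvscale.
Proof. by move=> f; apply/cvps_eqP => m; exact: mul1r. Qed.
Fact cvscaleDr : right_distributive cvscale +%R.
Proof. by move=> c f g; apply/cvps_eqP => m; exact: mulrDr. Qed.
Fact cvscaleDl f : {morph cvscale^~ f : a b / a + b}.
Proof. by move=> a b; apply/cvps_eqP => m; exact: mulrDl. Qed.

HB.instance Definition _ :=
  GRing.Zmodule_isLmodule.Build C P cvscaleA cvscale1 cvscaleDr cvscaleDl.

Fact cvscaleAl (c : C) f g : c *: (f * g) = (c *: f) * g.
Proof.
apply/cvps_eqP => a; rewrite /= /mulc mulr_sumr.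
by apply: eq_bigr => b _; rewrite mulrA.
Qed.

HB.instance Definition _ := GRing.Lmodule_isLalgebra.Build C P cvscaleAl.
HB.instance Definition _ := GRing.Lalgebra_isComAlgebra.Build C P.

Definition cvunit : {pred P} := fun f => `[< exists g, g * f = 1 >].
Definition cvinv f : P :=
  if pselect (exists g, g * f = 1) is left e then projT1 (cid e) else f.

Fact cvmulV : {in cvunit, left_inverse 1 cvinv *%R}.
Proof.
move=> f /asboolP uf; rewrite /cvinv; case: pselect => // e.
exact: (projT2 (cid e)).
Qed.
Fact cvunitP f g : g * f = 1 -> cvunit f.
Proof. by move=> gf; apply/asboolP; exists g. Qed.
Fact cvinv_out : {in [predC cvunit], cvinv =1 id}.
Proof. by move=> f /asboolP nf; rewrite /cvinv; case: pselect. Qed.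

HB.instance Definition _ :=
  GRing.ComNzRing_hasMulInverse.Build P cvmulV cvunitP cvinv_out.

Lemma cvps_low f : f != 0 ->
  exists2 N, exists2 a, mdeg a = N & f a != 0
  & forall a, (mdeg a < N)%N -> f a = 0.
Proof.
move=> f0; have ex : exists N, `[< exists2 a, mdeg a = N & f a != 0 >].
  have [a fa] : exists a, f a != 0.
    apply: contrapT => nf; move/eqP: f0; apply; apply/cvps_eqP => a.
    by apply/eqP/negPn/negP => fa; apply: nf; exists a.
  by exists (mdeg a); apply/asboolP; exists a.
case: (ex_minnP ex) => N /asboolP aN minN; exists N => // a aN'.
apply/eqP/negPn/negP => fa; move: aN'; rewrite ltnNge => /negP; apply.
by apply: minN; apply/asboolP; exists a.
Qed.

Fact cvps_integral f g : f * g = 0 -> (f == 0) || (g == 0).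
Proof.
move=> fg; apply/negPn; rewrite negb_or; apply/negP => /andP[].
move=> /cvps_low[N [a aN fa] fN] /cvps_low[M [b bM gb] gM].
pose p := trunc N.+1 f; pose q := trunc M.+1 g.
have pE c : p@_c = if (mdeg c < N.+1)%N then f c else 0.
  case: ltnP => [|Nc]; first exact: truncE.
  rewrite raddf_sum big1 //= => m _; rewrite mcoeffZ mcoeffX.
  case: eqP => [mc|]; last by rewrite mulr0.
  by move: (bmdeg m); rewrite mc ltnNge Nc.
have qE c : q@_c = if (mdeg c < M.+1)%N then g c else 0.
  case: ltnP => [|Nc]; first exact: truncE.
  rewrite raddf_sum big1 //= => m _; rewrite mcoeffZ mcoeffX.
  case: eqP => [mc|]; last by rewrite mulr0.
  by move: (bmdeg m); rewrite mc ltnNge Nc.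
have p0 : p != 0.
  by apply: contraNneq fa => p0; rewrite -(@truncE _ _ N.+1) ?aN // -/p p0 mcoeff0.
have q0 : q != 0.
  by apply: contraNneq gb => q0; rewrite -(@truncE _ _ M.+1) ?bM // -/q q0 mcoeff0.
have := mulf_neq0 p0 q0; case/eqP; apply/mpolyP => c; rewrite mcoeff0.
rewrite (mcoeffM_lin _ _ (ltnSn (mdeg c))).
have [cNM|cNM] := eqVneq (mdeg c) (N + M)%N; last first.
  apply: big1 => m mc; rewrite pE qE.
  case: (ltngtP (mdeg m) N) => [mN|mN|mN].
  - by rewrite fN // if_same mul0r.
  - by rewrite ltnNge mN /= mul0r.
  case: (ltngtP (mdeg (c - m)%MM) M) => [mM|mM|mM].
  - by rewrite gM // if_same mulr0.
  - by rewrite [(_ < M.+1)%N]ltnNge mM /= mulr0.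
  by move/eqP: cNM; case; rewrite -(submK mc) mdegD mN mM addnC.
transitivity ((f * g) c); last by rewrite fg.
apply: eq_bigr => m mc; rewrite pE qE.
have cE : (mdeg (c - m)%MM + mdeg m = N + M)%N by rewrite -mdegD submK.
case: (ltngtP (mdeg m) N) => [mN|mN|mN].
- by rewrite fN // if_same !mul0r.
- rewrite [(mdeg m < _)%N]ltnNge mN /= mul0r gM ?mulr0 //.
  by rewrite -(ltn_add2r N) (addnC M) -cE ltn_add2l.
have -> : mdeg (c - m)%MM = M.
  by apply/eqP; rewrite -(eqn_add2r N) -{1}mN cE addnC.
by rewrite mN !ltnSn.
Qed.

HB.instance Definition _ := GRing.ComUnitRing_isIntegral.Build P cvps_integral.

Definition pderiv (i : 'I_k) f : P := Cvps (convergent_pderiv i (cvpsP f)).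

End Ring.

Arguments mon {R k} a.
Arguments pderiv {R k} i f.

Section QuotientModule.
Context (A : comNzRingType) (V : lmodType A) (G : set V).

Definition lspan : set V :=
  [set v | exists m (a : 'I_m -> A) (w : 'I_m -> V),
     (forall i, G (w i)) /\ v = \sum_i a i *: w i].

Definition lspan_pred : {pred V} := fun v => `[< lspan v >].

Lemma lspanZ (a : A) v : lspan v -> lspan (a *: v).
Proof.
case=> m [b [w [Gw ->]]]; exists m, (fun i => a * b i), w; split => //.
by rewrite scaler_sumr; apply: eq_bigr => i _; rewrite scalerA.
Qed.

Lemma lspanD u v : lspan u -> lspan v -> lspan (u + v).
Proof.
move=> [m [a [w [Gw ->]]]] [m' [a' [w' [Gw' ->]]]].
exists (m + m')%N.
exists (fun i => match split i with inl j => a j | inr j => a' j end).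
exists (fun i => match split i with inl j => w j | inr j => w' j end).
split=> [i|]; first by case: (split i).
rewrite big_split_ord /=; congr (_ + _); apply: eq_bigr => i _.
  by rewrite -[lshift _ _]/(unsplit (inl i)) unsplitK.
by rewrite -[rshift _ _]/(unsplit (inr i)) unsplitK.
Qed.

Fact lspan_zmod_closed : zmod_closed lspan_pred.
Proof.
split=> [|u v /asboolP su /asboolP sv]; apply/asboolP.
  exists 0%N, (fun=> 0), (fun=> 0); split; last by rewrite big_ord0.
  by case.
by rewrite -scaleN1r; apply: lspanD => //; apply: lspanZ.
Qed.

HB.instance Definition _ := GRing.isZmodClosed.Build V lspan_pred lspan_zmod_closed.

Definition mquot : Type := Quotient.quot lspan_pred.
HB.instance Definition _ := GRing.Zmodule.on mquot.

Definition mproj (v : V) : mquot := \pi_(Quotient.quot lspan_pred) v.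

Lemma mprojP u v : mproj u = mproj v <-> lspan (u - v).
Proof.
rewrite /mproj; split => [/eqP|uv]; last apply/eqP.
  by rewrite -Quotient.idealrBE => /asboolP.
by rewrite -Quotient.idealrBE; apply/asboolP.
Qed.

Lemma mproj_surj (x : mquot) : exists v, x = mproj v.
Proof. by exists (repr (x : Quotient.quot lspan_pred)); rewrite /mproj reprK. Qed.

Lemma mprojD : {morph mproj : u v / u + v}.
Proof. exact: Quotient.pi_add. Qed.

Definition mscale (a : A) (x : mquot) : mquot :=
  mproj (a *: repr (x : Quotient.quot lspan_pred)).

Lemma mprojZ a v : mscale a (mproj v) = mproj (a *: v).
Proof.
apply/mprojP; rewrite -scalerBr; apply: lspanZ; apply/mprojP.
by rewrite /mproj reprK.
Qed.

Fact mscaleA a b x : mscale a (mscale b x) = mscale (a * b) x.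
Proof. by have [v ->] := mproj_surj x; rewrite !mprojZ scalerA. Qed.
Fact mscale1 : left_id 1 mscale.
Proof. by move=> x; have [v ->] := mproj_surj x; rewrite mprojZ scale1r. Qed.
Fact mscaleDr : right_distributive mscale +%R.
Proof.
move=> a x y; have [u ->] := mproj_surj x; have [v ->] := mproj_surj y.
by rewrite !mprojZ -!mprojD mprojZ scalerDr.
Qed.
Fact mscaleDl x : {morph mscale^~ x : a b / a + b}.
Proof.
by move=> a b; have [v ->] := mproj_surj x; rewrite !mprojZ -mprojD scalerDl.
Qed.

HB.instance Definition _ :=
  GRing.Zmodule_isLmodule.Build A mquot mscaleA mscale1 mscaleDr mscaleDl.

End QuotientModule.

Section ExteriorPower.
Context (A : comNzRingType) (V : lmodType A) (d : nat).
Local Notation T := ({ffun 'I_d -> V}).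

Definition upd (v : T) (i : 'I_d) (x : V) : T :=
  [ffun j => if j == i then x else v j].

Definition alternating_rel : set {freeg T / A} :=
  [set r | (exists (v : T) (i j : 'I_d),
              [/\ i != j, v i = v j & r = << v >>])
        \/ (exists (v : T) (i : 'I_d) (a : A) (x y : V),
              r = << upd v i (a *: x + y) >>
                  - (a *: << upd v i x >> + << upd v i y >>)) ].

(* The d-th exterior power of V: the free module on d-tuples, modulo the
   relations making [wedge] multilinear and alternating. *)
Definition extpow : lmodType A := mquot alternating_rel.
Definition wedge (v : T) : extpow := mproj alternating_rel << v >>.

End ExteriorPower.

(* Linear combinations of elements of G with coefficients in B.  For a subring
   B and G contained in B this is the ideal of B generated by G. *)
Definition span_over (A : comNzRingType) (B G : set A) : set A :=
  [set x | exists m (b : 'I_m -> A) (w : 'I_m -> A),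
     [/\ forall i, B (b i), forall i, G (w i) & x = \sum_i b i * w i]].

Definition ideal_gen (A : comNzRingType) (G : set A) : set A := span_over setT G.

Definition prec (d : nat) (u v : 'rV[rat]_d) : bool :=
  (u != v) && [forall i, u 0 i <= v 0 i].

Section Lattice.
Context (d : nat).
Implicit Types (A B : set 'rV[rat]_d) (lam : seq 'rV[rat]_d).

Definition cosets A B : set (set 'rV[rat]_d) :=
  [set [set a + b | b in B] | a in A].

(* The number of cosets; fset_set makes it 0 when there are infinitely many. *)
Definition index_of A B : nat := #|` fset_set (cosets A B)|.

(* M_j = Z^d + Z lambda_1 + ... + Z lambda_j; note that lambda_j is the entry
   of index j - 1 of the sequence [lam]. *)
Definition lattice lam (j : nat) : set 'rV[rat]_d :=
  [set m | exists (z : 'rV[int]_d) (c : 'I_j -> int),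
     m = map_mx intr z + \sum_(i < j) lam`_i *~ c i].

(* nidx lam j = n_{j+1} *)
Definition nidx lam (j : nat) : nat :=
  index_of (lattice lam j.+1) (lattice lam j).

(* lbar lam j = \overline\lambda_{j+1} *)
Fixpoint lbar lam (j : nat) : 'rV[rat]_d :=
  if j is i.+1
  then lbar lam i *+ nidx lam i + lam`_i.+1 - lam`_i
  else lam`_0.

(* gamma_1, ..., gamma_(d+g) *)
Definition gens g lam (i : 'I_(d + g)) : 'rV[rat]_d :=
  match split i with
  | inl i => delta_mx 0 i
  | inr j => lbar lam j
  end.

Definition psi g lam (a : 'X_{1..d + g}) : 'rV[rat]_d :=
  \sum_(i < d + g) gens lam i *+ a i.

Definition gamma0 g lam : 'rV[rat]_d :=
  \sum_(j < g) lbar lam j *+ (nidx lam j).-1 - const_mx 1.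

(* l is the exponent of the relation
   n_{j+1} lbar_{j+1} = \sum_i l_i e_i + \sum_(k < j) l_{d+k} lbar_{k+1}. *)
Definition semigroup_relation g lam (j : 'I_g) (l : 'X_{1..d + g}) : Prop :=
  [/\ forall i : 'I_(d + g), (d + j <= i)%N -> l i = 0%N,
      forall k : 'I_g, (k < j)%N -> (l (rshift d k) < nidx lam k)%N
    & lbar lam j *+ nidx lam j = psi lam l].

(* The rows of B form a Z-basis of M. *)
Definition lattice_basis (M : set 'rV[rat]_d) (B : 'M[rat]_d) : Prop :=
  B \in unitmx /\
  forall m, M m <-> exists z : 'rV[int]_d, m = map_mx intr z *m B.

End Lattice.

(* An element f of cvps R d is used in two ways: as an element of C{X_1..X_d},
   or as an element of C{X_1^(1/n)..X_d^(1/n)}, where the coefficient f a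
   belongs to the monomial X^(a/n).  [ramify n] is the inclusion of the former
   ring into the latter. *)
Section QuasiOrdinary.
Context (R : realType) (d : nat).
Local Notation P := (cvps R d).

Definition ramify (n : nat) (f : P) : P := Cvps (convergent_ramify n (cvpsP f)).

Definition expo (n : nat) (a : 'X_{1..d}) : 'rV[rat]_d :=
  \row_i ((a i)%:R / n%:R).

Definition weierstrass (n : nat) (f : {poly P}) : Prop :=
  [/\ f \is monic, size f = n.+1 & forall i, (i < n)%N -> (f`_i : P) 0%MM = 0].

Definition discriminant (f : {poly P}) : P :=
  (-1) ^+ 'C((size f).-1, 2) * resultant f f^`().

Definition quasi_ordinary (f : {poly P}) : Prop :=
  exists (delta : 'X_{1..d}) (eps : P),
    eps \is a GRing.unit /\ discriminant f = mon delta * eps.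

Definition irreducible (f : {poly P}) : Prop :=
  f \isn't a GRing.unit /\
  forall a b : {poly P}, f = a * b ->
    a \is a GRing.unit \/ b \is a GRing.unit.

Definition branch (n : nat) (f : {poly P}) (y : P) : Prop :=
  root (map_poly (ramify n) f) y.

Definition char_exponent (n : nat) (f : {poly P}) (lambda : 'rV[rat]_d) : Prop :=
  exists (y y' : P) (a : 'X_{1..d}) (eps : P),
    [/\ branch n f y, branch n f y' & y != y'] /\
    [/\ eps \is a GRing.unit, y - y' = mon a * eps & lambda = expo n a].

Definition char_exponents (n : nat) (f : {poly P}) (lam : seq 'rV[rat]_d) : Prop :=
  sorted (@prec d) lam /\ forall v, v \in lam <-> char_exponent n f v.

(* O_Z = C{sigma^vee /\ M}, as a subring of C{X^(1/n)}. *)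
Definition OZ (n : nat) (M : set 'rV[rat]_d) : set P :=
  [set f | forall a, f a != 0 -> M (expo n a)].

(* The Laurent monomial X^m, for m in (1/n)Z^d, in the fraction field; the
   variable of index i of P is X_i^(1/n). *)
Definition fracmon (n : nat) (m : 'rV[rat]_d) : {fraction P} :=
  \prod_(i < d) (tofrac (mon U_(i)%MM : P)) ^ numq (m 0 i *+ n).

End QuasiOrdinary.

Section Deformation.
Context (R : realType) (d g : nat) (lam : seq 'rV[rat]_d).
Local Notation C := (R[i]).

(* The data of an overweight deformation: the coefficients c_j, and the
   coefficients ca j a of the terms U^a of H_j. *)
Definition overweight (c : 'I_g -> C) (ca : 'I_g -> 'X_{1..d + g} -> C) : Prop :=
  (forall j : 'I_g, (c j == 0) = (j.+1 == g)) /\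
  (forall (j : 'I_g) (a : 'X_{1..d + g}), ca j a != 0 ->
     (forall i : 'I_(d + g), a i != 0%N -> (i <= d + j)%N) /\
     prec (lbar lam j *+ nidx lam j) (psi lam a)).

(* A point of the torus: a group homomorphism M -> C^*, m |-> t^m(p). *)
Definition torus_point (M : set 'rV[rat]_d) (p : 'rV[rat]_d -> C) : Prop :=
  (forall m, M m -> p m != 0) /\
  (forall m m', M m -> M m' -> p (m + m') = p m * p m').

Definition nextvar (j : 'I_g) : 'X_{1..d + g} :=
  [multinom nat_of_bool (i == (d + j.+1)%N :> nat) | i < d + g].

(* The coefficient of U^a in H_{j,p}; [ell j] is the exponent of the first
   monomial of h_j.  For the last j, c j = 0 and [nextvar j] is irrelevant. *)
Definition fiber_coefs (ell : 'I_g -> 'X_{1..d + g})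
    (c : 'I_g -> C) (ca : 'I_g -> 'X_{1..d + g} -> C) (p : 'rV[rat]_d -> C)
    (j : 'I_g) (a : 'X_{1..d + g}) : C :=
  (a == ell j)%:R - (a == (U_(rshift d j) *+ nidx lam j)%MM)%:R
  + c j * p (lbar lam j.+1 - lbar lam j *+ nidx lam j) * (a == nextvar j)%:R
  + ca j a * p (psi lam a - lbar lam j *+ nidx lam j).

End Deformation.

Section Germ.
Context (R : realType) (m : nat) (OS : comAlgType R[i]).
Context (pi : {lrmorphism cvps R m -> OS}).

(* OS = C{U_1..U_m} / (H_1, ..., H_g) via pi. *)
Definition local_ring_of g (H : 'I_g -> cvps R m) : Prop :=
  (forall x, exists F, x = pi F) /\
  (forall F, pi F = 0 <-> ideal_gen (range H) F).

Definition Jac g (H : 'I_g -> cvps R m) : set OS :=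
  ideal_gen [set pi (\det (\matrix_(j < g, k < g) pderiv (s k) (H j)))
            | s in [set s : 'I_g -> 'I_m |
                    forall k l : 'I_g, (k < l)%N -> (s k < s l)%N]].

Definition grad (F : cvps R m) : 'rV[OS]_m := \row_i pi (pderiv i F).

(* Analytic Kaehler differentials: the free module on dU_1, ..., dU_m modulo
   the differentials of the elements of the kernel of pi. *)
Definition Omega1 : lmodType OS := mquot [set grad F | F in [set F | pi F = 0]].

(* The differential of the class of F. *)
Definition dK (F : cvps R m) : Omega1 := mproj _ (grad F).

Definition Omega (d : nat) : lmodType OS := extpow Omega1 d.

End Germ.

Section Normalization.
Context (R : realType) (d g : nat) (n : nat) (M : set 'rV[rat]_d).
Context (OS : comAlgType R[i]) (pi : {lrmorphism cvps R (d + g) -> OS}).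
Context (nu : {lrmorphism OS -> cvps R d}).

(* Through nu, which maps U_i to X_i for i <= d, O_Z is the integral closure of
   OS in its fraction field; everything takes place in the fraction field of
   C{X^(1/n)}. *)
Definition normalization : Prop :=
  [/\ injective nu,
      forall i : 'I_d, nu (pi (mon U_(lshift g i)%MM)) = mon (U_(i) *+ n)%MM
    & forall w : {fraction cvps R d},
        (exists2 z, OZ n M z & w = tofrac z) <->
        (exists x y : OS, y != 0 /\ w = tofrac (nu x) / tofrac (nu y)) /\
        integralOver (fun x : OS => tofrac (nu x)) w].

Definition Jac_ext (H : 'I_g -> cvps R (d + g)) : set (cvps R d) :=
  span_over (OZ n M) [set nu x | x in Jac pi H].

(* expo n a *m invmx B is the vector of coordinates of the exponent a/n in the
   Z-basis of M given by the rows of B. *)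
Lemma convergent_dlog (B : 'M[rat]_d) (k : 'I_d) (f : 'X_{1..d} -> R[i]) :
  convergent f -> convergent (fun a => ratr ((expo n a *m invmx B) 0 k) * f a).
Proof.
pose b i : R[i] := `|ratr (invmx B i k / n%:R)|.
apply: (@convergent_weight _ _ _ (\sum_i b i)) => a.
rewrite mxE rmorph_sum /=; apply: le_trans (ler_norm_sum _ _ _) _.
rewrite mulr_suml; apply: ler_sum => i _.
have -> : expo n a 0 i * invmx B i k = (a i)%:R * (invmx B i k / n%:R).
  by rewrite mxE mulrAC mulrA.
rewrite rmorphM /= normrM ratr_nat normr_nat mulrC ler_wpM2l ?normr_ge0 //.
apply: le_trans (le_expn2 _ _); rewrite ler_nat.
exact: leq_trans (mnm_le_mdeg _ _) (leqnSn _).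
Qed.

(* For f = \sum c_a X^a, the k-th coordinate of \sum c_a X^a \otimes a. *)
Definition dlog (B : 'M[rat]_d) (k : 'I_d) (f : cvps R d) : cvps R d :=
  Cvps (convergent_dlog B k (cvpsP f)).

(* eta1 is the composite Omega^1_W -> Omega^1_Z -> O_Z \otimes M, where
   O_Z \otimes M is identified with O_Z^d through the basis B of M. *)
Definition log_map1 (B : 'M[rat]_d) (eta1 : Omega1 pi -> 'rV[cvps R d]_d) : Prop :=
  [/\ forall u v, eta1 (u + v) = eta1 u + eta1 v,
      forall a u, eta1 (a *: u) = nu a *: eta1 u
    & forall F, eta1 (dK pi F) = \row_k dlog B k (nu (pi F))].

(* etad is the composite Omega^d_W -> Omega^d_Z -> O_Z, the last arrow being the
   d-th exterior power of eta. *)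
Definition log_map (eta1 : Omega1 pi -> 'rV[cvps R d]_d)
    (etad : Omega pi d -> cvps R d) : Prop :=
  [/\ forall u v, etad (u + v) = etad u + etad v,
      forall a u, etad (a *: u) = nu a * etad u
    & forall w : {ffun 'I_d -> Omega1 pi},
        etad (wedge w) = \det (\matrix_(i < d, k < d) eta1 (w i) 0 k)].

Definition Jlog (etad : Omega pi d -> cvps R d) : set (cvps R d) :=
  span_over (OZ n M) (range etad).

End Normalization.

(* Main.v *)
(* Write phi for the composite of pi and nu, and u_i = phi(U_i).  An algebra
   morphism between rings of convergent power series is local, hence a
   substitution, so weights can be compared in the relations H_j(u) = 0: they
   force u_(d+j) = X^(lambda-bar_j) times a unit.  Therefore the Jacobian minor on
   the last g columns is X^(sum_j (n_j - 1) lambda-bar_j) times a unit.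

   Let J be the g x (d+g) matrix of the phi(dH_j/dU_i) and N the (d+g) x d matrix
   of the logarithmic derivatives of the u_i.  By the chain rule J N = 0, so a
   maximal minor of J and the complementary maximal minor of N are proportional,
   up to sign, with a ratio independent of the choice of columns.  On the last g
   columns this ratio is X^(gamma_0) times a unit of O_Z, because the first d rows
   of N have determinant X^(1,...,1) times a nonzero constant. *)

From HB Require Import structures.
Require Import Defs.
From mathcomp Require Import all_boot all_order all_fingroup all_algebra.
From mathcomp Require Import boolp classical_sets cardinality reals.
From mathcomp Require Import finmap complex freeg mpoly.

Set Implicit Arguments.
Unset Strict Implicit.
Unset Printing Implicit Defensive.

Import Order.TTheory GRing.Theory Num.Theory.

Local Open Scope classical_set_scope.
Local Open Scope ring_scope.

(** * Convergent power series *)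

(** The exponents are only partially ordered and [H_j] contains the next variable, so an induction
    on [j] alone cannot bound [u_(d+j)]. Instead an arbitrary positive integral weight on the
    variables X_i^(1/n) is fixed, and the bounds on the orders of all the [u_i] are raised together
    by small steps, starting from their mere vanishing at the origin. Divisibility by a monomial is
    then recovered from weights that strongly favour one coordinate. The leading coefficients are
    governed by the binomials alone, all other terms having strictly larger exponents. The chain
    rule J N = 0 comes from the linearity of the map on differentials: the image of the differential
    of [H_j] is computed in two ways. Both ideals are compared as spans over O_Z, so the ratio has
    to be a unit of O_Z and not merely of the ring of series in the X_i^(1/n). This is why
    membership of exponents in the lattice is tracked and why inverses are shown to stay in O_Z. *)

Section PowerSeries.
Context (R : realType) (k : nat).
Local Notation P := (cvps R k).
Implicit Types (f g h : P) (a b : 'X_{1..k}).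

Lemma cvcoefD f g a : (f + g) a = f a + g a.
Proof. by []. Qed.

Lemma cvcoefN f a : (- f) a = - f a.
Proof. by []. Qed.

Lemma cvcoef0 a : (0 : P) a = 0.
Proof. by []. Qed.

Lemma cvcoefZ (c : R[i]) f a : (c *: f) a = c * f a.
Proof. by []. Qed.

Lemma cvcoef1 a : (1 : P) a = (a == 0%MM)%:R.
Proof. by []. Qed.

Lemma cvcoef_sum (I : Type) (r : seq I) (Q : pred I) (F : I -> P) a :
  (\sum_(i <- r | Q i) F i) a = \sum_(i <- r | Q i) F i a.
Proof. by elim/big_rec2: _ => // i x y _ <-. Qed.

Lemma cvcoefM f g a :
  (f * g) a = \sum_(b : 'X_{1..k < (mdeg a).+1} | (b <= a)%MM) f b * g (a - b)%MM.
Proof. by []. Qed.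

Lemma cvcoefM0 f g : (f * g) 0%MM = f 0%MM * g 0%MM.
Proof.
have d0 : (mdeg (0%MM : 'X_{1..k}) < (mdeg (0%MM : 'X_{1..k})).+1)%N by [].
rewrite cvcoefM (bigD1 (BMultinom d0)) ?lepm_refl //= big1 => [|b].
  by rewrite addr0 subm0.
case/andP=> /mnm_lepP b0; rewrite bmeqP /= => /eqP[]; apply/mnmP => i.
by apply/eqP; rewrite mnm0E -leqn0; have := b0 i; rewrite mnm0E.
Qed.

Lemma cvcoefM_neq0 f g a : (f * g) a != 0 ->
  exists b c, [/\ a = (b + c)%MM, f b != 0 & g c != 0].
Proof.
rewrite cvcoefM => fg; have [b [ba fgb]] : exists b : 'X_{1..k},
    (b <= a)%MM /\ f b * g (a - b)%MM != 0.
  apply: contrapT => nb; move/eqP: fg; apply; apply: big1 => b ba.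
  by apply/eqP/negPn/negP => fgb; apply: nb; exists b.
exists b, (a - b)%MM; split; first by rewrite addmC submK.
  by apply: contraNneq fgb => ->; rewrite mul0r.
by apply: contraNneq fgb => ->; rewrite mulr0.
Qed.

Lemma cvcoef_monM a f b :
  (mon a * f) b = if (a <= b)%MM then f (b - a)%MM else 0.
Proof.
rewrite cvcoefM; case: ifP => ab.
  have aD : (mdeg a < (mdeg b).+1)%N by rewrite ltnS mdeg_le.
  rewrite (bigD1 (BMultinom aD)) //= eqxx mul1r big1 ?addr0 // => c /andP[_].
  by rewrite bmeqP /= => /negbTE->; rewrite mul0r.
apply: big1 => c cb /=; case: eqP => [ca|]; last by rewrite mul0r.
by rewrite ca ab in cb.
Qed.

Lemma cvcoef_monMD a f b : (mon a * f) (a + b)%MM = f b.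
Proof. by rewrite cvcoef_monM lem_addr ?lepm_refl // addmC addmK. Qed.

Lemma monD a b : mon (a + b)%MM = mon a * mon b :> P.
Proof.
apply/cvps_eqP => c; rewrite cvcoef_monM; case: ifP => [ac|/negP ac] /=.
  by rewrite -{1}(submK ac) (addmC a b) (inj_eq (@addIm _ a)).
by case: eqP => // cE; case: ac; rewrite cE lem_addr // lepm_refl.
Qed.

Lemma mon0 : mon 0%MM = 1 :> P.
Proof. by []. Qed.

Lemma mon_neq0 a : mon a != 0 :> P.
Proof. by apply/eqP => /cvps_eqP /(_ a)/eqP; rewrite /= eqxx oner_eq0. Qed.

Lemma mon_mul a n : mon (a *+ n)%MM = mon a ^+ n :> P.
Proof. by elim: n => [|n IHn]; rewrite ?mulm0n ?mon0 // exprS -IHn mulmS monD. Qed.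

Lemma mon_sum (I : Type) (r : seq I) (Q : pred I) (F : I -> 'X_{1..k}) :
  mon (\sum_(i <- r | Q i) F i)%MM = \prod_(i <- r | Q i) mon (F i) :> P.
Proof. by elim/big_rec2: _ => [|i x y _ <-]; rewrite ?mon0 ?monD. Qed.

Lemma mon_prod a : mon a = \prod_i mon U_(i)%MM ^+ a i :> P.
Proof.
rewrite {1}[a]multinomUE_id mon_sum; apply: eq_bigr => i _; exact: mon_mul.
Qed.

Lemma convergent_shift a (f : 'X_{1..k} -> R[i]) : convergent f ->
  convergent (fun b => f (a + b)%MM).
Proof.
case=> r r0 [K fK]; exists r => //; exists (K / r ^+ mdeg a) => D.
rewrite ler_pdivlMr ?exprn_gt0 // mulr_suml.
have F0 b : 0 <= `|f b| * r ^+ mdeg b by rewrite mulr_ge0 ?exprn_ge0 // ltW.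
pose s := [seq (a + bmnm x)%MM | x <- index_enum 'X_{1..k < D}].
have us : uniq s.
  rewrite map_inj_uniq ?index_enum_uniq // => x y.
  by rewrite !(addmC a) => /addIm/val_inj.
have := sum_seq_le F0 fK us; rewrite big_map; apply: le_trans.
by apply: ler_sum => x _; rewrite mdegD exprD -mulrA [r ^+ _ * _]mulrC.
Qed.

(** Division by the monomial of exponent [a]. Terms not divisible by it are dropped, so the quotient
    is exact only under the hypothesis of [shiftK]. *)
Definition cvshift a f : P := Cvps (convergent_shift a (cvpsP f)).

Lemma shiftK a f : (forall b, f b != 0 -> (a <= b)%MM) -> mon a * cvshift a f = f.
Proof.
move=> fa; apply/cvps_eqP => b; rewrite cvcoef_monM /=; case: ifP => ab.
  by rewrite addmC submK.
by apply/esym/eqP/negPn/negP => /fa; rewrite ab.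
Qed.

Lemma convergent_restrict (Q : pred 'X_{1..k}) (f : 'X_{1..k} -> R[i]) :
  convergent f -> convergent (fun b => (Q b)%:R * f b).
Proof.
apply: (@convergent_weight _ _ _ 1) => b; rewrite mul1r.
apply: (@le_trans _ _ 1); first by case: (Q b); rewrite ?normr1 ?normr0 ?ler01.
by rewrite exprn_ege1 // ler1n.
Qed.

(** Serves twice: to extract an initial form for a weight, and to project onto the exponents lying
    in the lattice. *)
Definition cvrestrict (Q : pred 'X_{1..k}) f : P :=
  Cvps (convergent_restrict Q (cvpsP f)).

End PowerSeries.

(** * Weighted orders and units *)

Section WeightedOrder.
Context (R : realType) (k : nat) (w : 'I_k -> nat).
Local Notation P := (cvps R k).
Implicit Types (f g h : P) (a b : 'X_{1..k}) (t : nat).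

Definition wt a : nat := \sum_i w i * a i.

Lemma wtD a b : wt (a + b)%MM = (wt a + wt b)%N.
Proof. by rewrite /wt -big_split; apply: eq_bigr => i _; rewrite mnmDE mulnDr. Qed.

Lemma wt0 : wt 0%MM = 0%N.
Proof. by rewrite /wt big1 // => i _; rewrite mnm0E muln0. Qed.

Lemma wt_mul a n : wt (a *+ n)%MM = (wt a * n)%N.
Proof. by elim: n => [|n IHn]; rewrite ?mulm0n ?muln0 ?wt0 // mulmS wtD IHn mulnS. Qed.

Lemma wt_sum (I : Type) (r : seq I) (F : I -> 'X_{1..k}) :
  wt (\sum_(i <- r) F i)%MM = (\sum_(i <- r) wt (F i))%N.
Proof. by elim/big_rec2: _ => [|i x y _ <-]; rewrite ?wt0 ?wtD. Qed.

(** A lower bound for the order rather than the order itself, so that the zero series needs no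
    special value. *)
Definition ord t f : Prop := forall b, f b != 0 -> (t <= wt b)%N.

Lemma ordP t f : ord t f <-> forall b, (wt b < t)%N -> f b = 0.
Proof.
split=> h b; first by move=> bt; apply/eqP/negPn/negP => /h; rewrite leqNgt bt.
by move=> fb; rewrite leqNgt; apply/negP => /h /eqP; apply/negP.
Qed.

Lemma ord_le t t' f : (t <= t')%N -> ord t' f -> ord t f.
Proof. by move=> tt' h b /h; apply: leq_trans. Qed.

Lemma ordD t f g : ord t f -> ord t g -> ord t (f + g).
Proof.
by move=> /ordP hf /ordP hg; apply/ordP => b bt; rewrite cvcoefD hf ?hg ?addr0.
Qed.

Lemma ordN t f : ord t f -> ord t (- f).
Proof. by move=> /ordP hf; apply/ordP => b bt; rewrite cvcoefN hf ?oppr0. Qed.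

Lemma ordB t f g : ord t f -> ord t g -> ord t (f - g).
Proof. by move=> hf hg; apply: ordD => //; apply: ordN. Qed.

Lemma ordM t t' f g : ord t f -> ord t' g -> ord (t + t') (f * g).
Proof. by move=> hf hg b /cvcoefM_neq0[c [e [-> /hf c_ /hg]]]; rewrite wtD; apply: leq_add. Qed.

Lemma ord1 : ord 0 1.
Proof. by []. Qed.

Lemma ordX t f n : ord t f -> ord (n * t) (f ^+ n).
Proof. by move=> hf; elim: n => [|n IHn]; [exact: ord1|rewrite exprS mulSn; apply: ordM]. Qed.

Lemma ord_sum (I : Type) (r : seq I) (Q : pred I) (F : I -> P) t :
  (forall i, Q i -> ord t (F i)) -> ord t (\sum_(i <- r | Q i) F i).
Proof. by move=> h; elim/big_rec: _ => [b /eqP//|i x /h]; apply: ordD. Qed.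

(** The bound is required only for factors that occur: in a relation of the semigroup the sharper
    bounds are known only for the earlier variables. *)
Lemma ord_prod (I : Type) (r : seq I) (F : I -> P) (e t : I -> nat) :
  (forall i, e i != 0 -> ord (t i) (F i)) ->
  ord (\sum_(i <- r) e i * t i) (\prod_(i <- r) F i ^+ e i).
Proof.
move=> h; elim/big_rec2: _ => [|i s x _ hx]; first exact: ord1.
apply: ordM => //; have [->|e0] := eqVneq (e i) 0; last exact: ordX (h _ e0).
by rewrite mul0n expr0; apply: ord1.
Qed.

(* Otherwise f has an initial form f' <> 0 of weight v <= t: f ^+ n - f' ^+ n has
   weight more than n v, and f' ^+ n is homogeneous of weight n v, hence 0. *)
Lemma ord_root t f n : ord (n * t).+1 (f ^+ n) -> ord t.+1 f.
Proof.
move=> fn b fb; have [//|bt] := ltnP t (wt b); exfalso.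
have ex : exists v, `[< exists2 b, wt b = v & f b != 0 >].
  by exists (wt b); apply/asboolP; exists b.
case: (ex_minnP ex) => v /asboolP[c cv fc] minv.
have vt : (v <= t)%N by apply: leq_trans bt; apply: minv; apply/asboolP; exists b.
have fv : ord v f by move=> e fe; apply: minv; apply/asboolP; exists e.
pose f' := cvrestrict (fun e => wt e == v) f.
have f'E e : f' e = (wt e == v)%:R * f e by [].
have f'v : ord v f' by move=> e; rewrite f'E mulf_eq0 negb_or => /andP[_ /fv].
have rv : ord v.+1 (f - f').
  apply/ordP => e; rewrite ltnS leq_eqVlt cvcoefD cvcoefN f'E.
  case/orP => [->|ev]; first by rewrite mul1r subrr.
  by move/ordP: fv => /(_ _ ev) ->; rewrite mulr0 subrr.
have f'n e : (f' ^+ n) e != 0 -> wt e = (n * v)%N.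
  elim: n e {fn} => [|m IHm] e.
    by rewrite expr0 cvcoef1 mul0n; case: (e =P 0%MM) => [-> _|_ /eqP//]; rewrite wt0.
  rewrite exprS => /cvcoefM_neq0[x [y [-> + /IHm yv]]].
  rewrite f'E mulf_eq0 negb_or wtD yv mulSn => /andP[+ _].
  by case: (wt x =P v) => [->|_ /eqP].
have f'0 : f' ^+ n = 0.
  apply/cvps_eqP => e; apply/eqP/negPn/negP => fe; have := f'n _ fe.
  apply/eqP; rewrite neq_ltn; apply/orP; right.
  suff : ord (n * v).+1 (f' ^+ n) by apply.
  rewrite -(subKr (f ^+ n) (f' ^+ n)); apply: ordB.
    by apply: ord_le fn; rewrite ltnS leq_mul2l vt orbT.
  case: (n) => [|m]; first by rewrite !expr0 subrr => x /eqP.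
  (* The factor [f - f'] has order at least v + 1, and each term of the cofactor is a product of m
     factors of order at least v. *)
  rewrite subrXX mulSn -addSn; apply: ordM => //; apply: ord_sum => i _.
  have -> : (m * v)%N = ((m - i) * v + i * v)%N.
    by rewrite -mulnDl subnK // -ltnS.
  by apply: ordM; apply: ordX.
have : f' = 0 by apply/eqP; move/eqP: f'0; rewrite expf_eq0 => /andP[].
move/cvps_eqP/(_ c); rewrite f'E cv eqxx mul1r => /eqP.
by rewrite (negbTE fc).
Qed.

End WeightedOrder.

Section Units.
Context (R : realType) (k : nat).
Local Notation P := (cvps R k).
Implicit Types (f g h : P) (a b : 'X_{1..k}).

Lemma wt_mdeg a : wt (fun=> 1%N) a = mdeg a.
Proof. by rewrite mdegE; apply: eq_bigr => i _; rewrite mul1n. Qed.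

Definition psum (r : R[i]) D f : R[i] := \sum_(a : 'X_{1..k < D}) `|f a| * r ^+ mdeg a.

(** Unlike in [convergentM], the radius and the bound are explicit: the geometric series below needs
    all powers bounded at one radius. *)
Lemma psumM (r K K' : R[i]) f g : 0 < r ->
  (forall D, psum r D f <= K) -> (forall D, psum r D g <= K') ->
  forall D, psum r D (f * g) <= K * K'.
Proof.
move=> r0 fK gK D; pose F h a := `|h a| * r ^+ mdeg a.
have F0 h a : 0 <= F h a by rewrite mulr_ge0 // exprn_ge0 // ltW.
have K'0 : 0 <= K' by apply: le_trans (gK 0%N); apply: sumr_ge0 => a _; exact: F0.
have -> : psum r D (f * g) = \sum_(a : 'X_{1..k < D})
   `|\sum_(b : 'X_{1..k < D} | (b <= a)%MM) f b * g (a - b)%MM| * r ^+ mdeg a.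
  by apply: eq_bigr => a _; rewrite /= (mulc_widen _ _ (bmdeg a)).
apply: (@le_trans _ _ (\sum_(a : 'X_{1..k < D})
          \sum_(b : 'X_{1..k < D} | (b <= a)%MM) F f b * F g (a - b)%MM)).
  apply: ler_sum => a _.
  rewrite (le_trans (ler_wpM2r _ (ler_norm_sum _ _ _))) ?exprn_ge0 ?(ltW r0) //.
  rewrite mulr_suml; apply: ler_sum => b ba.
  by rewrite normrM mulrACA -exprD -mdegD addmC submK.
rewrite (exchange_big_dep xpredT) //= (le_trans _ (ler_wpM2r K'0 (fK D))) //.
rewrite mulr_suml; apply: ler_sum => b _; rewrite -mulr_sumr ler_wpM2l //.
pose s := [seq (bmnm x - b)%MM | x <- index_enum 'X_{1..k < D} & (b <= bmnm x)%MM].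
have us : uniq s.
  rewrite map_inj_in_uniq ?filter_uniq ?index_enum_uniq // => x y.
  rewrite !mem_filter => /andP[bx _] /andP[b_y _] xy.
  by apply/val_inj; rewrite /= -(submK bx) xy submK.
by have := sum_seq_le (F0 g) gK us; rewrite big_map big_filter.
Qed.

(** After normalizing the constant term to 1, the inverse is the geometric series in [h]. It
    converges because [h] has no constant term, so its norm drops below 1/2 on a small polydisc. *)
Lemma unit_coef0 f : (f \is a GRing.unit) = (f 0%MM != 0).
Proof.
apply/idP/idP => [uf|f0].
  have := congr1 (fun g => coefs g 0%MM) (mulrV uf); rewrite cvcoefM0 cvcoef1 eqxx.
  by apply: contra_eqN => /eqP->; rewrite mul0r eq_sym oner_eq0.
pose h : P := 1 - (f 0%MM)^-1 *: f.
have h0 : h 0%MM = 0 by rewrite /h cvcoefD cvcoefN cvcoefZ cvcoef1 eqxx mulVf ?subrr.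
have fE : f = f 0%MM *: (1 - h) by rewrite subKr scalerA divff // scale1r.
suff [g gh] : exists g : P, g * (1 - h) = 1.
  apply/unitrPr; exists ((f 0%MM)^-1 *: g).
  by rewrite {1}fE -scalerAr -scalerAl scalerA mulVf // scale1r mulrC.
have h1 : ord (fun=> 1%N) 1 h.
  move=> b; rewrite wt_mdeg lt0n mdeg_eq0; apply: contraNneq => ->.
  by rewrite h0.
have hX n b : (mdeg b < n)%N -> (h ^+ n) b = 0.
  by have /ordP := ordX (n := n) h1; rewrite muln1 -wt_mdeg; apply.
have [s s0 hs] : exists2 s : R[i], 0 < s & forall D, psum s D h <= 2^-1.
  case: (cvpsP h) => r r0 [K hK].
  have K0 : 0 <= K.
    by apply: le_trans (hK 0%N); apply: sumr_ge0 => a _; rewrite mulr_ge0 ?exprn_ge0 // ltW.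
  (* Scaling the radius by [t <= 1] multiplies every term of positive degree by at most [t], and t K
     <= 1/2; the summand 1 keeps the denominator positive when [K] is 0. *)
  pose t : R[i] := (2 * (K + 1))^-1.
  have K1 : 0 < K + 1 by rewrite ltr_wpDl.
  have t0 : 0 < t by rewrite invr_gt0 mulr_gt0.
  have t1 : t <= 1.
    rewrite invf_le1 ?mulr_gt0 // (le_trans (ler1n _ 2)) //.
    by rewrite ler_peMr // lerDr.
  exists (t * r); first exact: mulr_gt0.
  move=> D; apply: (@le_trans _ _ (t * K)); last first.
    by rewrite /t invfM -mulrA ler_piMr ?invr_ge0 // mulrC ler_pdivrMr // mul1r lerDl.
  apply: le_trans (ler_wpM2l (ltW t0) (hK D)); rewrite mulr_sumr.
  apply: ler_sum => a _; have [a0|a0] := posnP (mdeg a).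
    by move/eqP: a0; rewrite mdeg_eq0 => /eqP->; rewrite h0 normr0 !mul0r mulr0.
  rewrite exprMn mulrCA ler_wpM2r ?mulr_ge0 ?exprn_ge0 ?(ltW r0) //.
  by rewrite -(prednK a0) exprS ler_piMr ?(ltW t0) // exprn_ile1 // ltW.
have hn n D : psum s D (h ^+ n) <= 2^-1 ^+ n.
  elim: n D => [|n IHn] D; last by rewrite !exprS; apply: psumM.
  have [->|D0] := posnP D.
    by rewrite /psum big1 ?ler01 // => -[a].
  have d0 : (mdeg (0%MM : 'X_{1..k}) < D)%N by rewrite mdeg0.
  rewrite /psum (bigD1 (BMultinom d0)) //= eqxx mdeg0 normr1 mulr1 big1 ?addr0 // => a.
  by rewrite bmeqP => /negbTE/= ->; rewrite normr0 mul0r.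
(* Powers of [h] beyond the degree of [a] do not reach the coefficient [a], so the infinite sum is
   finite coefficientwise and may be cut at any larger bound. *)
pose G a := \sum_(j < (mdeg a).+1) (h ^+ j) a.
have GE D a : (mdeg a < D)%N -> G a = \sum_(j < D) (h ^+ j) a.
  move=> aD; rewrite /G (big_ord_widen _ (fun j => (h ^+ j) a) aD).
  rewrite [RHS](bigID (fun j : 'I_D => (j < (mdeg a).+1)%N)) /=.
  rewrite [X in _ + X]big1 ?addr0 // => j; rewrite -leqNgt; exact: hX.
have cG : convergent G.
  exists s => //; exists 2 => D.
  apply: (@le_trans _ _ (\sum_(j < D) psum s D (h ^+ j))).
    rewrite exchange_big /=; apply: ler_sum => a _; rewrite (GE _ _ (bmdeg a)).
    by rewrite -mulr_suml ler_wpM2r ?ler_norm_sum // exprn_ge0 // ltW.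
  apply: (@le_trans _ _ (\sum_(j < D) 2^-1 ^+ j)); first exact: ler_sum.
  suff -> : \sum_(j < D) 2^-1 ^+ j = 2 - 2 * 2^-1 ^+ D :> R[i].
    by rewrite gerBl mulr_ge0 ?exprn_ge0 ?invr_ge0.
  elim: D => [|D IHD]; first by rewrite big_ord0 expr0 mulr1 subrr.
  rewrite big_ord_recr IHD /= exprS mulrA divff ?pnatr_eq0 // mul1r.
  by rewrite mulr_natl mulr2n opprD -!addrA addNr addr0.
exists (Cvps cG); apply/cvps_eqP => a; set D := (mdeg a).+1.
have -> : (Cvps cG * (1 - h)) a = ((\sum_(j < D) h ^+ j) * (1 - h)) a.
  rewrite !cvcoefM; apply: eq_bigr => b ba; rewrite cvcoef_sum /=.
  by rewrite (GE D) // ltnS mdeg_le.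
have -> : (\sum_(j < D) h ^+ j) * (1 - h) = 1 - h ^+ D.
  by rewrite -[LHS]opprK -mulrN opprB mulrC -subrX1 opprB.
by rewrite cvcoefD cvcoefN hX ?subr0.
Qed.

End Units.

(** * Algebra morphisms are substitutions *)

Section Euler.
Context (R : realType) (k : nat).
Local Notation P := (cvps R k).
Implicit Types (f g h : P) (a b : 'X_{1..k}).

Lemma mnm1_le (i : 'I_k) a : (U_(i) <= a)%MM = (0 < a i)%N.
Proof.
apply/mnm_lepP/idP => [/(_ i)|ai j]; first by rewrite mnm1E eqxx.
by rewrite mnm1E; case: eqP => // <-.
Qed.

Lemma euler (i : 'I_k) f a : (mon U_(i) * pderiv i f) a = (a i)%:R * f a.
Proof.
rewrite cvcoef_monM mnm1_le; have [->|ai] := posnP (a i); first by rewrite mul0r.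
rewrite /= submK ?mnm1_le // mnmBE mnm1E eqxx subn1 prednK //.
Qed.

Lemma convergent_divdeg f :
  convergent (fun a => (mdeg a).+1%:R^-1 * f a).
Proof.
apply: (@convergent_weight _ _ _ 1); last exact: cvpsP.
move=> a; rewrite mul1r ger0_norm ?invr_ge0 ?ler0n //.
apply: (@le_trans _ _ 1); first by rewrite invf_le1 ?ltr0n // ler1n.
by rewrite exprn_ege1 // ler1n.
Qed.

(** The integral of f(sX) over s in [0, 1], written coefficientwise; with it [hadamard] is
    Hadamard's lemma at the origin. *)
Definition divdeg f : P := Cvps (convergent_divdeg f).

(* Euler's identity, the sum of the U_i df/dU_i being |a| f_a in degree a. *)
Lemma hadamard f : f 0%MM = 0 ->
  f = \sum_i mon U_(i)%MM * divdeg (pderiv i f).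
Proof.
move=> f0; apply/cvps_eqP => a; rewrite cvcoef_sum.
have [->|a0] := eqVneq a 0%MM.
  by rewrite f0 big1 // => i _; rewrite cvcoef_monM mnm1_le mnm0E.
have a0' : (mdeg a)%:R != 0 :> R[i] by rewrite pnatr_eq0 mdeg_eq0.
transitivity (\sum_i (mdeg a)%:R^-1 * ((a i)%:R * f a)).
  by rewrite -mulr_sumr -mulr_suml -natr_sum -mdegE mulrA mulVf // mul1r.
apply: eq_bigr => i _; rewrite -euler !cvcoef_monM; case: ifP => [ai|_]; last first.
  by rewrite mulr0.
rewrite /=; congr ((_%:R)^-1 * _).
by rewrite -[in LHS](submK ai) mdegD mdeg1 addn1.
Qed.

Lemma ord_divdeg_pderiv (i : 'I_k) t f :
  ord (fun=> 1%N) t.+1 f -> ord (fun=> 1%N) t (divdeg (pderiv i f)).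
Proof.
move=> hf a /=; rewrite mulf_eq0 negb_or => /andP[_].
rewrite mulf_eq0 negb_or => /andP[_ /hf].
by rewrite !wt_mdeg mdegD mdeg1 addn1.
Qed.

End Euler.

Section Substitution.
Context (R : realType) (m d : nat).
Context (phi : {lrmorphism cvps R m -> cvps R d}).
Local Notation u i := (phi (mon U_(i)%MM)).

(** If the constant term c of [u i] were nonzero, U_i - c would be a unit whose image vanishes at
    the origin. *)
Lemma morph_local (i : 'I_m) : u i 0%MM = 0.
Proof.
apply/eqP/negPn/negP => c0; set c := u i 0%MM in c0.
have : (mon U_(i)%MM - c%:A : cvps R m) \is a GRing.unit.
  rewrite unit_coef0 cvcoefD cvcoefN cvcoefZ cvcoef1 eqxx mulr1 /=.
  by rewrite [0%MM == _]eq_sym mnm1_eq0 sub0r oppr_eq0.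
move/(rmorph_unit phi); rewrite unit_coef0 rmorphB /= linearZ /= rmorph1.
by rewrite cvcoef1 eqxx mulr1 subrr eqxx.
Qed.

Lemma ord_var (i : 'I_m) : ord (fun=> 1%N) 1 (u i).
Proof.
move=> b; rewrite wt_mdeg lt0n mdeg_eq0; apply: contraNneq => ->.
by rewrite morph_local.
Qed.

(** By [hadamard], a series of order t + 1 is a finite sum of products of a variable and a series of
    order t. Thus continuity of [phi] for the adic topology follows from algebra alone. *)
Lemma ord_morph t F : ord (fun=> 1%N) t F -> ord (fun=> 1%N) t (phi F).
Proof.
elim: t F => [//|t IHt] F hF.
rewrite (@hadamard _ _ F); last by move/ordP: hF; apply; rewrite wt0.
rewrite linear_sum; apply: ord_sum => i _; rewrite rmorphM -(add1n t).
by apply: ordM; [exact: ord_var|exact/IHt/ord_divdeg_pderiv].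
Qed.

Lemma morph_mon a : phi (mon a) = \prod_i u i ^+ a i.
Proof. by rewrite {1}mon_prod rmorph_prod; apply: eq_bigr => i _; rewrite rmorphXn. Qed.

(** The tail of [F] from degree [D] on is mapped to order at least [D], so it cannot contribute to
    the coefficient [b]. *)
Lemma morph_coef F D (b : 'X_{1..d}) : (mdeg b < D)%N ->
  phi F b = \sum_(a : 'X_{1..m < D}) F a * phi (mon a) b.
Proof.
move=> bD; have : ord (fun=> 1%N) D (F - \sum_(a : 'X_{1..m < D}) F a *: mon a).
  apply/ordP => a; rewrite wt_mdeg cvcoefD cvcoefN cvcoef_sum => aD.
  rewrite (bigD1 (BMultinom aD)) //= eqxx mulr1 big1 ?addr0 ?subrr // => x.
  by rewrite bmeqP eq_sym /= => /negbTE->; rewrite mulr0.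
move/ord_morph/ordP/(_ b); rewrite wt_mdeg => /(_ bD)/eqP.
rewrite rmorphB rmorph_sum cvcoefD cvcoefN subr_eq0 => /eqP->.
by rewrite cvcoef_sum; apply: eq_bigr => a _; rewrite /= linearZ.
Qed.

Lemma morph_coef_neq0 F (b : 'X_{1..d}) : phi F b != 0 ->
  exists2 a, F a != 0 & phi (mon a) b != 0.
Proof.
move=> Fb; apply: contrapT => na; move/eqP: Fb; apply.
rewrite (morph_coef F (ltnSn _)) big1 // => a _; apply/eqP/negPn/negP.
by rewrite mulf_eq0 negb_or => /andP[Fa ub]; apply: na; exists (bmnm a).
Qed.

Context (Gam : 'I_m -> 'X_{1..d}) (y : 'I_m -> cvps R d).
Hypothesis uE : forall i, u i = mon (Gam i) * y i.

Definition mdot (a : 'X_{1..m}) : 'X_{1..d} := (\sum_i Gam i *+ a i)%MM.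

Lemma mdot_var i k : mdot (U_(i) *+ k)%MM = (Gam i *+ k)%MM.
Proof.
rewrite /mdot (bigD1 i) //= mulmnE mnm1E eqxx mul1n big1 ?addm0 // => l.
by rewrite eq_sym mulmnE mnm1E => /negbTE->.
Qed.

Definition mval (a : 'X_{1..m}) : R[i] := \prod_i y i 0%MM ^+ a i.

Lemma cvcoefX0 (f : cvps R d) n : (f ^+ n) 0%MM = f 0%MM ^+ n.
Proof.
elim: n => [|n IHn]; first by rewrite !expr0 cvcoef1 eqxx.
by rewrite !exprS cvcoefM0 IHn.
Qed.

Lemma morph_monE a : phi (mon a) = mon (mdot a) * \prod_i y i ^+ a i.
Proof.
rewrite morph_mon /mdot mon_sum -big_split /=; apply: eq_bigr => i _.
by rewrite uE exprMn mon_mul.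
Qed.

Lemma morph_mon_coef a L : (L <= mdot a)%MM ->
  phi (mon a) L = (mdot a == L)%:R * mval a.
Proof.
move=> La; rewrite morph_monE; case: eqP => [<-|aL].
  rewrite -{2}[mdot a]addm0 cvcoef_monMD /mval mul1r.
  by elim/big_rec2: _ => [|i x z _ <-]; rewrite ?cvcoef1 ?eqxx // cvcoefM0 cvcoefX0.
rewrite mul0r cvcoef_monM; case: ifP => // aL'; case: aL; apply/mnmP => i; apply/eqP.
by rewrite eqn_leq (mnm_lepP aL') (mnm_lepP La).
Qed.

Lemma morph_ge (F : cvps R m) (L b : 'X_{1..d}) : (forall a, F a != 0 -> (L <= mdot a)%MM) ->
  phi F b != 0 -> (L <= b)%MM.
Proof.
move=> FL /morph_coef_neq0[a /FL La]; rewrite morph_monE cvcoef_monM.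
by case: ifP => [ab _|_ /eqP//]; apply: lepm_trans ab.
Qed.

(** The bound [D] is left free so that the sum can later be made to contain prescribed monomials of
    [F]. *)
Lemma morph_lead (F : cvps R m) (L : 'X_{1..d}) D :
  (forall a, F a != 0 -> (L <= mdot a)%MM) -> (mdeg L < D)%N ->
  phi F L = \sum_(a : 'X_{1..m < D}) (mdot a == L)%:R * (F a * mval a).
Proof.
move=> FL LD; rewrite (morph_coef F LD); apply: eq_bigr => a _.
have [->|Fa] := eqVneq (F a) 0; first by rewrite !(mul0r, mulr0).
by rewrite morph_mon_coef ?FL // mulrCA.
Qed.

End Substitution.

(** * Leading monomials of overweight systems *)

Section ConstantCoefficient.
Context (R : realType) (k : nat).
Local Notation P := (cvps R k).

(** Packaged as a ring morphism, so that determinants can be evaluated at the origin entry by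
    entry. *)
Definition const_coef (f : P) : R[i] := f 0%MM.

Fact const_coef_zmod : zmod_morphism const_coef.
Proof. by []. Qed.

Fact const_coef_monoid : monoid_morphism const_coef.
Proof. by split=> [|f g]; rewrite /const_coef ?cvcoefM0 // cvcoef1 eqxx. Qed.

HB.instance Definition _ := GRing.isZmodMorphism.Build P R[i] const_coef const_coef_zmod.
HB.instance Definition _ := GRing.isMonoidMorphism.Build P R[i] const_coef const_coef_monoid.

End ConstantCoefficient.

Section PositiveWeights.
Context (k : nat) (w : 'I_k -> nat).
Hypothesis w_gt0 : forall i, (0 < w i)%N.
Implicit Types a b : 'X_{1..k}.

Lemma wt_gt0 a : a != 0%MM -> (0 < wt w a)%N.
Proof.
move=> a0; rewrite lt0n; apply: contra a0 => /eqP wa; apply/eqP/mnmP => i.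
move: wa; rewrite /wt (bigD1 i) //= => /eqP; rewrite addn_eq0 muln_eq0.
by rewrite eqn0Ngt w_gt0 mnm0E /= => /andP[/eqP].
Qed.

Lemma wt_lt a b : (a <= b)%MM -> a != b -> (wt w a < wt w b)%N.
Proof.
move=> ab a_b; rewrite -(submK ab) wtD -[X in (X < _)%N]add0n ltn_add2r.
apply: wt_gt0; apply: contra a_b => /eqP ba0.
by rewrite -(submK ab) ba0 add0m.
Qed.

End PositiveWeights.

Lemma sum_bmultinom_pred1 (A : nzRingType) k D (a : 'X_{1..k}) (F : 'X_{1..k} -> A) :
  (mdeg a < D)%N ->
  \sum_(x : 'X_{1..k < D}) (bmnm x == a)%:R * F x = F a.
Proof.
move=> aD; rewrite (bigD1 (BMultinom aD)) //= eqxx mul1r big1 ?addr0 // => x.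
by rewrite bmeqP /= => /negbTE->; rewrite mul0r.
Qed.

Section OverweightSystem.
Context (R : realType) (d g : nat).
Context (phi : {lrmorphism cvps R (d + g) -> cvps R d}).
Context (Gam : 'I_(d + g) -> 'X_{1..d}) (nn : 'I_g -> nat).
Context (ell : 'I_g -> 'X_{1..d + g}) (H : 'I_g -> cvps R (d + g)).
Local Notation u i := (phi (mon U_(i)%MM)).
Local Notation L j := (Gam (rshift d j) *+ nn j)%MM.
Local Notation pow j := (U_(rshift d j) *+ nn j)%MM.
Hypothesis Gam_neq0 : forall i, Gam i != 0%MM.
Hypothesis nn_gt0 : forall j, (0 < nn j)%N.
Hypothesis ell_supp : forall (j : 'I_g) (i : 'I_(d + g)), (d + j <= i)%N -> ell j i = 0%N.
Hypothesis ell_dot : forall j, mdot Gam (ell j) = L j.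
Hypothesis H_ell : forall j, H j (ell j) = 1.
Hypothesis H_pow : forall j, H j (pow j) = -1.
Hypothesis H_over : forall j a, a != ell j -> a != pow j -> H j a != 0 ->
  (L j <= mdot Gam a)%MM /\ L j != mdot Gam a.
Hypothesis phi_coord : forall i : 'I_d, u (lshift g i) = mon (Gam (lshift g i)).
Hypothesis phi_H : forall j, phi (H j) = 0.

Lemma wt_mdot w a : wt w (mdot Gam a) = (\sum_i a i * wt w (Gam i))%N.
Proof. by rewrite wt_sum; apply: eq_bigr => i _; rewrite wt_mul mulnC. Qed.

Lemma ell_var (j : 'I_g) (i : 'I_(d + g)) : ell j i != 0%N -> (i < d + j)%N.
Proof. by apply: contraR; rewrite -leqNgt => /ell_supp ->. Qed.

(** Ensures that the first monomial of the binomial really gains weight when the bounds on its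
    variables become strict. *)
Lemma ell_neq0 j : ell j != 0%MM.
Proof.
apply: contraTneq (Gam_neq0 (rshift d j)) => e0; apply/negPn/eqP/mnmP => i.
have /mnmP/(_ i) := ell_dot j; rewrite e0 mulmnE /mdot mnm_sumE mnm0E.
rewrite big1 => [|l _]; last by rewrite mnm0E mulm0n mnm0E.
by move/esym/eqP; rewrite muln_eq0 [_ == 0%N in X in _ || X]eqn0Ngt nn_gt0 orbF => /eqP.
Qed.

(* Bootstrapping: all u_i have weight at least q/N times the expected one, for
   q = 1, ..., N; the relations H_j make the inequality strict at each step. *)
Lemma ord_Gam w i : (forall l, (0 < w l)%N) -> ord w (wt w (Gam i)) (u i).
Proof.
move=> w0; pose W x := wt w (Gam x).
have W0 l : (0 < W l)%N by apply: wt_gt0.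
(* A common multiple of the expected orders. For the weight scaled by [N], the fraction q/N of the
   expected order of [u l] is the integer [q * W l]. *)
pose N := (\prod_l W l)%N.
have WN l : (W l %| N)%N by rewrite /N (bigD1 l) //= dvdn_mulr.
have N0 : (0 < N)%N by rewrite prodn_gt0.
pose w' l := (N * w l)%N.
have w'E b : wt w' b = (N * wt w b)%N.
  by rewrite /wt big_distrr; apply: eq_bigr => l _; rewrite /w' -mulnA.
suff main q : (q < N)%N -> forall l, ord w' (q.+1 * W l) (u l).
  move=> b ub; have := @main N.-1; rewrite prednK // => /(_ (leqnn _) i b ub).
  by rewrite w'E leq_pmul2l.
elim: q => [_ l b ub|q IHq qN].
  rewrite w'E mul1n (leq_trans (dvdn_leq N0 (WN l))) // leq_pmulr //.
  apply: wt_gt0 => //; apply: contraNneq ub => ->; apply/eqP; exact: morph_local.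
have {}IHq := IHq (ltnW qN).
(* Values of the scaled weight are multiples of [N], hence of [W x]: one that exceeds (q+1) [W x] is
   at least (q+2) [W x]. *)
suff strict x : ord w' (q.+1 * W x).+1 (u x).
  move=> l b /strict; rewrite w'E -(divnK (WN l)) [((N %/ W l) * _)%N]mulnC -mulnA.
  by rewrite [(q.+1 * _)%N]mulnC [(q.+2 * _)%N]mulnC ltn_pmul2l // leq_pmul2l.
have coord (l : 'I_d) : ord w' (q.+1 * W (lshift g l)).+1 (u (lshift g l)).
  move=> b; rewrite phi_coord /=; case: (b =P Gam (lshift g l)) => [-> _|_ /eqP//].
  by rewrite w'E ltn_pmul2r.
(* Within one step [j] increases, since [ell j] involves only earlier variables, whose bounds are
   already strict. The overweight terms may involve later variables; there the old bounds suffice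
   because the exponents are strictly larger. *)
suff gen n (j : 'I_g) : (j < n)%N -> ord w' (q.+1 * W (rshift d j)).+1 (u (rshift d j)).
  case: (split_ordP x) => j ->; [exact: coord|exact: gen (ltnSn _)].
elim: n j => // n IHn j jn.
have lower (l : 'I_(d + g)) : (l < d + j)%N -> ord w' (q.+1 * W l).+1 (u l).
  case: (split_ordP l) => i' -> /=; first by move=> _; apply: coord.
  by rewrite ltn_add2l => ij; apply: IHn; apply: leq_trans ij _.
apply: (@ord_root _ _ _ _ _ (nn j)).
have -> : u (rshift d j) ^+ nn j = phi (H j + mon (pow j)).
  by rewrite rmorphD /= phi_H add0r mon_mul rmorphXn.
move=> b /morph_coef_neq0[a Ga ab].
have Lw : (nn j * (q.+1 * W (rshift d j)) = q.+1 * wt w (L j))%N.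
  by rewrite wt_mul mulnCA [(nn j * _)%N]mulnC.
move: ab; rewrite morph_mon Lw.
have [->|a_ell] := eqVneq a (ell j).
  have h (l : 'I_(d + g)) : ell j l != 0%N -> ord w' (q.+1 * W l).+1 (u l).
    by move/ell_var/lower.
  move/(ord_prod (r := index_enum _) h); apply: leq_trans.
  (* Each occurrence of a variable gains one unit of weight, in total the degree of [ell j], which
     is positive. *)
  rewrite (eq_bigr (fun l => q.+1 * (ell j l * W l) + ell j l)%N) => [|l _].
    rewrite big_split -big_distrr -mdegE /= -ell_dot wt_mdot -addn1 leq_add2l.
    by rewrite lt0n mdeg_eq0 ell_neq0.
  by rewrite mulnS addnC mulnCA.
have [aE|a_pow] := eqVneq a (pow j).
  by move: Ga; rewrite cvcoefD aE H_pow /= eqxx addNr eqxx.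
have [La aL] : (L j <= mdot Gam a)%MM /\ L j != mdot Gam a.
  by apply: H_over => //; move: Ga; rewrite cvcoefD /= (negbTE a_pow) addr0.
have h (l : 'I_(d + g)) : a l != 0%N -> ord w' (q.+1 * W l) (u l) by [].
move/(ord_prod (r := index_enum _) h); apply: leq_trans.
rewrite (eq_bigr (fun l => q.+1 * (a l * W l))%N) => [|l _]; last by rewrite mulnCA.
by rewrite -big_distrr -wt_mdot ltn_pmul2l // wt_lt.
Qed.

(** The weight 1 + K on coordinate [l] and 1 elsewhere, with K the degree of [b], detects that
    coordinate: if b_l were smaller than that of [Gam i], the weight K (b_l + 1) of [b] would be
    below the weight of [Gam i]. *)
Lemma supp_var i b : u i b != 0 -> (Gam i <= b)%MM.
Proof.
move=> ub; apply/mnm_lepP => l; pose K := mdeg b.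
pose w l' := (1 + K * (l' == l))%N.
have wE a : wt w a = (mdeg a + K * a l)%N.
  rewrite /wt mdegE (eq_bigr (fun l' => a l' + K * ((l' == l) * a l'))%N).
    rewrite big_split -big_distrr /=; congr (_ + K * _)%N.
    by rewrite (bigD1 l) //= eqxx mul1n big1 ?addn0 // => l' /negbTE->.
  by move=> l' _; rewrite /w mulnDl mul1n mulnA.
have /(_ _ ub) : ord w (wt w (Gam i)) (u i) by apply: ord_Gam.
rewrite !wE -/K; apply: contraLR; rewrite -!ltnNge => lt.
rewrite -mulnS (leq_ltn_trans (leq_mul (leqnn K) lt)) // -[X in (X < _)%N]add0n.
rewrite ltn_add2r (leq_trans _ (mnm_le_mdeg _ l)) //; exact: leq_ltn_trans lt.
Qed.

Definition lead_unit i : cvps R d := cvshift (Gam i) (u i).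
Local Notation y := lead_unit.

Lemma lead_unitE i : u i = mon (Gam i) * y i.
Proof. by rewrite shiftK //; apply: supp_var. Qed.

Lemma mval_pow j : mval y (pow j) = y (rshift d j) 0%MM ^+ nn j.
Proof.
rewrite /mval (bigD1 (rshift d j)) //= mulmnE mnm1E eqxx mul1n big1 ?mulr1 // => i.
by rewrite eq_sym mulmnE mnm1E => /negbTE->.
Qed.

Lemma ell_pow j : ell j != pow j.
Proof.
apply/eqP => /mnmP/(_ (rshift d j)); rewrite ell_supp // mulmnE mnm1E eqxx mul1n.
by move/eqP; rewrite eq_sym eqn0Ngt nn_gt0.
Qed.

(** Used with [h] equal to 1 for the relation itself, and with [h a] the exponent of U_(d+k) for its
    Euler derivative. In both cases only the two monomials of the binomial reach the exponent
    [L j]. *)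
Lemma lead_relation j (F : cvps R (d + g)) (h : 'X_{1..d + g} -> R[i]) :
  (forall a, F a = h a * H j a) ->
  phi F = mon (L j) * cvshift (L j) (phi F) /\
  phi F (L j) = h (ell j) * mval y (ell j) - h (pow j) * mval y (pow j).
Proof.
move=> FE; have FL a : F a != 0 -> (L j <= mdot Gam a)%MM.
  rewrite FE mulf_eq0 negb_or => /andP[_ Ha].
  have [->|ae] := eqVneq a (ell j); first by rewrite ell_dot lepm_refl.
  have [->|ap] := eqVneq a (pow j); first by rewrite mdot_var lepm_refl.
  by have [] := H_over ae ap Ha.
split; first by rewrite shiftK // => b; apply: morph_ge FL; apply: lead_unitE.
pose D := (mdeg (L j) + mdeg (ell j) + mdeg (pow j)).+1.
rewrite (morph_lead lead_unitE FL (D := D)); last by rewrite ltnS -addnA leq_addr.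
rewrite -(@sum_bmultinom_pred1 _ _ D (ell j) (fun a => h a * mval y a)); last first.
  by rewrite ltnS -addnA addnCA leq_addr.
rewrite -(@sum_bmultinom_pred1 _ _ D (pow j) (fun a => h a * mval y a)); last first.
  by rewrite ltnS leq_addl.
rewrite -sumrB; apply: eq_bigr => a _; rewrite -mulrBl FE.
have [->|ae] := eqVneq (bmnm a) (ell j).
  by rewrite (negbTE (ell_pow j)) ell_dot eqxx subr0 !mul1r H_ell mulr1.
have [->|ap] := eqVneq (bmnm a) (pow j).
  by rewrite mdot_var eqxx sub0r mul1r H_pow mulrN1 mulN1r mulNr.
rewrite subr0 mul0r; have [->|Ha] := eqVneq (H j a) 0; first by rewrite mulr0 mul0r mulr0.
by have [_] := H_over ae ap Ha; rewrite eq_sym => /negbTE->; rewrite mul0r.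
Qed.

(** At the exponent [L j] the relation [H j] says that the [nn j]-th power of the leading
    coefficient of [u (rshift d j)] is a monomial in earlier leading coefficients; induction on [j]
    applies. *)
Lemma lead_unit_neq0 i : y i 0%MM != 0.
Proof.
have coord (l : 'I_d) : y (lshift g l) = 1.
  apply: (mulfI (mon_neq0 _ (Gam (lshift g l)))).
  by rewrite -lead_unitE phi_coord mulr1.
suff gen n (j : 'I_g) : (j < n)%N -> y (rshift d j) 0%MM != 0.
  case: (split_ordP i) => j ->; last exact: gen (ltnSn _).
  by rewrite coord cvcoef1 eqxx oner_eq0.
elim: n j => // n IHn j jn.
have [|_] := @lead_relation j (H j) (fun=> 1); first by move=> a; rewrite mul1r.
rewrite phi_H cvcoef0 !mul1r mval_pow => /esym/eqP; rewrite subr_eq0 => /eqP E.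
have : mval y (ell j) != 0.
  apply/prodf_neq0 => l _; case: (split_ordP l) => i' ->.
    by rewrite coord cvcoef1 eqxx expr1n oner_eq0.
  have [->|e0] := eqVneq (ell j (rshift d i')) 0%N; first by rewrite expr0 oner_eq0.
  rewrite expf_neq0 // IHn //; apply: leq_trans (jn : (j <= n)%N).
  by have := ell_var e0; rewrite /= ltn_add2l.
by rewrite E expf_eq0 nn_gt0.
Qed.

(* Multiplying column k by u_k and dividing row j by the monomial of exponent L j
   leaves a matrix E which at the origin is triangular with a nonzero diagonal. *)
Lemma lead_jacobian : exists2 V : cvps R d, V \is a GRing.unit &
  \det (\matrix_(j < g, k < g) phi (pderiv (rshift d k) (H j)))
  = mon (\sum_(j < g) Gam (rshift d j) *+ (nn j).-1)%MM * V.
Proof.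
set Dm := \matrix_(j, k) _.
pose F j k := mon U_(rshift d k)%MM * pderiv (rshift d k) (H j).
pose E := \matrix_(j < g, k < g) cvshift (L j) (phi (F j k)).
have FE j k a : F j k a = (a (rshift d k))%:R * H j a by apply: euler.
have DE : Dm *m diag_mx (\row_k u (rshift d k)) = diag_mx (\row_j mon (L j)) *m E.
  apply/matrixP => j k; rewrite mul_mx_diag mul_diag_mx !mxE.
  have [<- _] := lead_relation (FE j k).
  by rewrite /F rmorphM mulrC.
have uE : \det E \is a GRing.unit.
  rewrite unit_coef0 -[_ 0%MM]/(const_coef _) -det_map_mx.
  (* For k > j neither monomial of the binomial involves U_(d+k); on the diagonal only the pure
     power does, which leaves [- nn j] times a power of a leading coefficient. *)
  have trig : is_trig_mx (map_mx (@const_coef R d) E).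
    apply/is_trig_mxP => j k jk; rewrite !mxE /const_coef /= addm0.
    have [_ ->] := lead_relation (FE j k).
    rewrite ell_supp ?leq_add2l ?(ltnW jk) //= mulmnE mnm1E eq_rshift.
    by rewrite -val_eqE (ltn_eqF jk) !mul0r subrr.
  rewrite det_trig //; apply/prodf_neq0 => j _; rewrite !mxE /const_coef /= addm0.
  have [_ ->] := lead_relation (FE j j).
  rewrite ell_supp // mulmnE mnm1E eqxx mul0r sub0r oppr_eq0 mul1n mval_pow.
  by rewrite mulf_neq0 ?expf_neq0 ?lead_unit_neq0 // pnatr_eq0 -lt0n.
have uY : \prod_k y (rshift d k) \is a GRing.unit.
  apply: rpred_prod => k _; rewrite unit_coef0; exact: lead_unit_neq0.
exists (\det E / \prod_k y (rshift d k)); first by rewrite unitrM unitrV uE.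
apply: (mulIr uY); rewrite -!mulrA mulVr // mulr1.
apply: (mulfI (mon_neq0 R (\sum_(j < g) Gam (rshift d j))%MM)).
have := congr1 determinant DE; rewrite !det_mulmx !det_diag.
have -> : \prod_i (\row_k u (rshift d k)) 0 i
        = mon (\sum_(j < g) Gam (rshift d j))%MM * \prod_k y (rshift d k).
  by rewrite mon_sum -big_split; apply: eq_bigr => k _; rewrite mxE lead_unitE.
have -> : \prod_i (\row_j mon (L j)) 0 i = mon (\sum_(j < g) L j)%MM :> cvps R d.
  by rewrite mon_sum; apply: eq_bigr => k _; rewrite mxE.
rewrite mulrCA => ->; rewrite mulrA -monD; congr (mon _ * _).
rewrite -big_split; apply: eq_bigr => j _ /=.
by rewrite -mulmS prednK.
Qed.

End OverweightSystem.

(** * Complementary minors *)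

Definition increasing p q (s : 'I_p -> 'I_q) : Prop :=
  forall k l : 'I_p, (k < l)%N -> (s k < s l)%N.

Lemma increasing_inj p q (s : 'I_p -> 'I_q) : increasing s -> injective s.
Proof.
move=> s_incr k l kl; case: (ltngtP k l) => [/s_incr|/s_incr|/val_inj//];
by rewrite kl ltnn.
Qed.

(** The ambient size is a variable tied by an equation because complements are taken both of [d] and
    of [g] indices among [d + g]. *)
Lemma increasing_complement p q n (f : 'I_p -> 'I_n) : n = (p + q)%N ->
  injective f -> exists2 e : 'I_q -> 'I_n, increasing e & forall i j, f i != e j.
Proof.
move=> npq f_inj; pose A := [predC codom f].
have cardA : #|A| = q.
  apply/(@addnI p); rewrite -npq -[X in _ = X]card_ord -(cardC (mem (codom f))).
  by rewrite card_codom // card_ord.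
have sortedA : sorted (relpre val ltn) (enum A).
  rewrite /enum_mem -enumT; apply: sorted_filter => [x y z|]; first exact: ltn_trans.
  by rewrite -sorted_map val_enum_ord iota_ltn_sorted.
exists (fun i => enum_val (cast_ord (esym cardA) i)) => [k l kl|i j].
  have szA : size (enum A) = q by rewrite -cardE.
  have x0 : 'I_n := enum_val (cast_ord (esym cardA) k).
  rewrite !(enum_val_nth x0) /=.
  apply: (sorted_ltn_nth _ _ sortedA) => //; rewrite ?inE ?szA //.
  by move=> x y z; apply: ltn_trans.
have := enum_valP (cast_ord (esym cardA) j); rewrite inE.
by apply: contraNneq => <-; apply: codom_f.
Qed.

Lemma perm_of_split d g (t : 'I_d -> 'I_(d + g)) (s : 'I_g -> 'I_(d + g)) :
  injective t -> injective s -> (forall i j, t i != s j) ->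
  exists pi : {perm 'I_(d + g)},
    (forall i, pi (lshift g i) = t i) /\ (forall j, pi (rshift d j) = s j).
Proof.
move=> t_inj s_inj ts; pose f i := match split i with inl k => t k | inr k => s k end.
have fl i : f (lshift g i) = t i by rewrite /f -[lshift _ _]/(unsplit (inl i)) unsplitK.
have fr j : f (rshift d j) = s j by rewrite /f -[rshift _ _]/(unsplit (inr j)) unsplitK.
have f_inj : injective f.
  move=> x y; case: (split_ordP x) => i ->; case: (split_ordP y) => j ->.
  - by rewrite !fl => /t_inj ->.
  - by rewrite fl fr => /eqP; rewrite (negbTE (ts _ _)).
  - by rewrite fl fr => /esym/eqP; rewrite (negbTE (ts _ _)).
  - by rewrite !fr => /s_inj ->.
by exists (perm f_inj); split=> i; rewrite permE.
Qed.

Section ComplementaryMinors.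
Context (A : comNzRingType) (d g : nat).
Context (J : 'M[A]_(g, d + g)) (N : 'M[A]_(d + g, d)).
Hypothesis JN : J *m N = 0.

(* Multiply by the square matrix (N | K) where K consists of the last g columns of
   the identity: the product is block triangular since J N = 0. *)
Lemma det_col_rowsub (t : 'I_d -> 'I_(d + g)) :
  \det (col_mx (rowsub t 1%:M) J) * \det (usubmx N)
  = \det (rowsub t N) * \det (rsubmx J).
Proof.
pose K : 'M[A]_(d + g, g) := col_mx 0 1%:M.
have NK : \det (row_mx N K) = \det (usubmx N).
  by rewrite -{1}(vsubmxK N) -block_mxEh det_lblock det1 mulr1.
have JK : J *m K = rsubmx J.
  by rewrite -{1}(hsubmxK J) mul_row_col mulmx0 mulmx1 add0r.
rewrite -NK -det_mulmx mul_col_row JN JK det_ublock.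
by rewrite mul_rowsub_mx mul1mx.
Qed.

(** Moving the columns selected by [t] to the front turns the stacked matrix into a block triangular
    one with an identity block; the sign is that of the permutation. *)
Lemma det_colsub_complement (pi : {perm 'I_(d + g)}) :
  \det (colsub (fun k => pi (rshift d k)) J)
  = (-1) ^+ pi * \det (col_mx (rowsub (fun k => pi (lshift g k)) 1%:M) J).
Proof.
set t := fun k => pi (lshift g k); set s := fun k => pi (rshift d k).
have -> : \det (colsub s J) = \det (block_mx 1%:M 0 (colsub t J) (colsub s J)).
  by rewrite det_lblock det1 mul1r.
have -> : block_mx 1%:M 0 (colsub t J) (colsub s J)
        = col_perm pi (col_mx (rowsub t 1%:M) J).
  apply/matrixP => i j; rewrite [RHS]mxE.
  case: (split_ordP i) => i' ->; case: (split_ordP j) => j' ->.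
  - by rewrite block_mxEul col_mxEu !mxE /t (inj_eq perm_inj) eq_lshift.
  - by rewrite block_mxEur col_mxEu !mxE /t (inj_eq perm_inj) eq_lrshift.
  - by rewrite block_mxEdl col_mxEd !mxE.
  - by rewrite block_mxEdr col_mxEd !mxE.
rewrite col_permE det_mulmx det_perm odd_permV mulrC.
by [].
Qed.

Lemma complementary_minors (pi : {perm 'I_(d + g)}) :
  \det (colsub (fun k => pi (rshift d k)) J) * \det (usubmx N)
  = (-1) ^+ pi * (\det (rowsub (fun k => pi (lshift g k)) N) * \det (rsubmx J)).
Proof. by rewrite det_colsub_complement -mulrA det_col_rowsub. Qed.

End ComplementaryMinors.

(** * Characteristic exponents *)

Section Exponents.
Context (d n : nat).
Hypothesis n_gt0 : (0 < n)%N.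
Implicit Types a b : 'X_{1..d}.

Let n_neq0 : n%:R != 0 :> rat.
Proof. by rewrite pnatr_eq0 -lt0n. Qed.

Lemma expoD a b : expo n (a + b)%MM = expo n a + expo n b.
Proof. by apply/rowP => i; rewrite !mxE mnmDE natrD mulrDl. Qed.

Lemma expo0 : expo n (0%MM : 'X_{1..d}) = 0.
Proof. by apply/rowP => i; rewrite !mxE mnm0E mul0r. Qed.

Lemma expo_mul a k : expo n (a *+ k)%MM = expo n a *+ k.
Proof. by elim: k => [|k IHk]; rewrite ?mulm0n ?expo0 // mulmS expoD IHk mulrS. Qed.

Lemma expo_sum (I : Type) (r : seq I) (F : I -> 'X_{1..d}) :
  expo n (\sum_(i <- r) F i)%MM = \sum_(i <- r) expo n (F i).
Proof. by elim/big_rec2: _ => [|i x y _ <-]; rewrite ?expo0 ?expoD. Qed.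

Lemma expo_inj : injective (@expo d n).
Proof.
move=> a b /rowP ab; apply/mnmP => i; have := ab i; rewrite !mxE.
by move/(mulIf (invr_neq0 n_neq0))/eqP; rewrite eqr_nat => /eqP.
Qed.

Lemma prec_expo a b : prec (expo n a) (expo n b) -> (a <= b)%MM /\ a != b.
Proof.
case/andP=> nab /forallP ab; split; last by apply: contraNneq nab => ->.
apply/mnm_lepP => i; have := ab i; rewrite !mxE ler_pM2r ?invr_gt0 ?ltr0n //.
by rewrite ler_nat.
Qed.

Lemma expo_unit (i : 'I_d) : expo n (U_(i) *+ n)%MM = delta_mx 0 i.
Proof.
apply/rowP => l; rewrite !mxE eqxx /= mulmnE mnm1E eq_sym.
by case: (l == i); rewrite ?mul1n ?mul0n ?mul0r ?divff.
Qed.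

End Exponents.

Section Characteristic.
Context (R : realType) (d n : nat) (f : {poly cvps R d}).

(** In degree 0 a monic polynomial is 1, a unit. Positivity gives the division by [n] in [expo] its
    meaning. *)
Lemma weierstrass_deg_gt0 : weierstrass n f -> irreducible f -> (0 < n)%N.
Proof.
case=> f_monic f_size _ [f_nunit _]; rewrite lt0n; apply/eqP => n0.
case/negP: f_nunit; rewrite n0 in f_size.
have [c fE] : exists c, f = c%:P by exists f`_0; apply: size1_polyC; rewrite f_size.
move/monicP: f_monic; rewrite fE lead_coefC => ->; exact: rpred1.
Qed.

Hypothesis f_weierstrass : weierstrass n f.

Lemma ramify_const (h : cvps R d) : ramify n h 0%MM = h 0%MM.
Proof.
rewrite /= /ramify_coefs ifT; last by apply/forallP => i; rewrite mnm0E dvdn0.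
by congr (coefs h); apply/mnmP => i; rewrite mnmE mnm0E div0n.
Qed.

(** At the origin a Weierstrass polynomial reduces to Y^n. *)
Lemma branch_const y : branch n f y -> y 0%MM = 0.
Proof.
case: f_weierstrass => f_monic f_size f_low /eqP/(congr1 (fun h => coefs h 0%MM)).
have r0 : ramify n 0 = 0 :> cvps R d.
  by apply/cvps_eqP => a; rewrite /= /ramify_coefs if_same.
rewrite (@horner_coef_wide _ n.+1); last first.
  by rewrite (leq_trans (size_poly _ _)) ?f_size.
rewrite big_ord_recr cvcoefD cvcoef_sum big1 => [|i _].
  rewrite add0r cvcoefM0 cvcoefX0 coef_map_id0 // ramify_const.
  rewrite (_ : f`_n = 1); last first.
    by move/monicP: f_monic; rewrite lead_coefE f_size.
  by rewrite cvcoef1 eqxx mul1r => /eqP; rewrite expf_eq0 => /andP[_ /eqP].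
by rewrite cvcoefM0 coef_map_id0 // ramify_const (f_low _ (ltn_ord i)) mul0r.
Qed.

(** With exponent 0 the difference of two branches would be a unit, although both vanish at the
    origin. *)
Lemma char_exponent_expo v : char_exponent n f v ->
  exists2 a, a != 0%MM & v = expo n a.
Proof.
case=> y [y' [a [eps [[by_ by' yy'] [ue yE ->]]]]]; exists a => //.
apply: contraTneq ue => a0; rewrite unit_coef0 negbK.
have := congr1 (fun h => coefs h 0%MM) yE.
rewrite a0 mon0 mul1r cvcoefD cvcoefN (branch_const by_) (branch_const by').
by rewrite subrr => <-.
Qed.

End Characteristic.

Section Index.
Context (d n : nat) (lam : seq 'rV[rat]_d).
Hypothesis n_gt0 : (0 < n)%N.

Lemma lattice0 j : lattice lam j 0.
Proof.
exists 0, (fun=> 0); rewrite raddf0 add0r big1 // => i _; exact: mulr0z.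
Qed.

Lemma latticeD j u v : lattice lam j u -> lattice lam j v -> lattice lam j (u + v).
Proof.
move=> [z [c ->]] [z' [c' ->]]; exists (z + z'), (fun i => c i + c' i).
rewrite raddfD /= addrACA -big_split; congr (_ + _); apply: eq_bigr => i _.
by rewrite mulrzDr.
Qed.

Lemma latticeN j u : lattice lam j u -> lattice lam j (- u).
Proof.
move=> [z [c ->]]; exists (- z), (fun i => - c i).
by rewrite raddfN opprD -sumrN; congr (_ + _); apply: eq_bigr => i _; rewrite mulrNz.
Qed.

Lemma latticeB j u v : lattice lam j u -> lattice lam j v -> lattice lam j (u - v).
Proof. by move=> hu /latticeN; apply: latticeD. Qed.

Lemma latticeMz j u k : lattice lam j u -> lattice lam j (u *~ k).
Proof.
move=> [z [c ->]]; exists (z *~ k), (fun i => c i * k).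
rewrite raddfMz mulrzDl mulrz_suml; congr (_ + _); apply: eq_bigr => i _.
by rewrite mulrzA.
Qed.

Lemma lattice_expo_unit j (a : 'X_{1..d}) : lattice lam j (expo n (a *+ n)%MM).
Proof.
exists (\row_i (a i)%:Z), (fun=> 0).
rewrite big1 ?addr0 => [|l _]; last exact: mulr0z.
by apply/rowP => l; rewrite !mxE mulmnE natrM mulfK ?pnatr_eq0 -?lt0n.
Qed.

Lemma lattice_lam j k : (j < k)%N -> lattice lam k lam`_j.
Proof.
move=> jk; exists 0, (fun i => (i == Ordinal jk)%:Z).
rewrite raddf0 add0r (bigD1 (Ordinal jk)) //= eqxx mulr1z big1 ?addr0 // => i.
by move/negbTE->; rewrite mulr0z.
Qed.

(* n lambda is integral, so the cosets are those of the multiples r lambda with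
   0 <= r < n. *)
Lemma nidx_gt0 j a : lam`_j = expo n a -> (0 < nidx lam j)%N.
Proof.
move=> lamE; rewrite /nidx /index_of.
pose C u : set 'rV[rat]_d := [set u + b | b in lattice lam j].
have CE u v : lattice lam j (u - v) -> C u = C v.
  move=> uv; apply/seteqP; split=> x [b hb <-].
    exists (u - v + b); first exact: latticeD.
    by rewrite addrA [v + _]addrC subrK.
  exists (b - (u - v)); first exact: latticeB.
  by rewrite opprB addrCA [u + _]addrC addrNK addrC.
have fin : finite_set (cosets (lattice lam j.+1) (lattice lam j)).
  apply: (@sub_finite_set _ _ [set C (lam`_j *~ (nat_of_ord r)%:Z) | r in [set: 'I_n]]);
    last exact/finite_image/finite_finset.
  move=> _ [u [z [c ->]] <-]; rewrite big_ord_recr /= addrA.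
  set v := _ + \sum_(i < j) _; set k := c _.
  have hv : lattice lam j v by exists z, (fun i => c (widen_ord (leqnSn j) i)).
  have r_lt : (`|(k %% n)%Z| < n)%N.
    by rewrite -ltz_nat gez0_abs ?modz_ge0 ?ltz_pmod // gt_eqF // ltz_nat.
  exists (Ordinal r_lt) => //; apply/esym; rewrite -/(C _); apply: CE.
  rewrite /= gez0_abs ?modz_ge0 ?gt_eqF ?ltz_nat // -addrA; apply: latticeD => //.
  rewrite -mulrzBr {1}(divz_eq k n) addrK mulrC mulrzA; apply: latticeMz.
  by rewrite lamE -pmulrn -expo_mul; apply: lattice_expo_unit.
rewrite cardfs_gt0; apply/fset0Pn.
by exists (C 0); rewrite in_fset_set //; apply/mem_set; exists 0 => //; exact: lattice0.
Qed.

End Index.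

(** * Ideals, the normalization and differentials *)

Section Span.
Context (A : comNzRingType) (B G : set A).

Lemma span_over_ind (Q : set A) :
  Q 0 -> (forall x y, Q x -> Q y -> Q (x + y)) ->
  (forall b x, B b -> Q x -> Q (b * x)) -> (forall x, G x -> Q x) ->
  forall x, span_over B G x -> Q x.
Proof.
move=> Q0 QD QM QG _ [m [b [w [Bb Gw ->]]]].
by elim/big_ind: _ => // i _; apply: QM => //; apply: QG.
Qed.

Lemma span_over0 : span_over B G 0.
Proof. by exists 0%N, (fun=> 0), (fun=> 0); split; [case|case|rewrite big_ord0]. Qed.

Lemma span_overD x y : span_over B G x -> span_over B G y -> span_over B G (x + y).
Proof.
move=> [m [b [w [Bb Gw ->]]]] [m' [b' [w' [Bb' Gw' ->]]]].
exists (m + m')%N, (fun i => match split i with inl j => b j | inr j => b' j end),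
  (fun i => match split i with inl j => w j | inr j => w' j end).
split=> [i|i|]; [by case: (split i)|by case: (split i)|].
rewrite big_split_ord /=; congr (_ + _); apply: eq_bigr => i _.
  by rewrite -[lshift _ _]/(unsplit (inl i)) unsplitK.
by rewrite -[rshift _ _]/(unsplit (inr i)) unsplitK.
Qed.

Lemma span_overM : (forall x y, B x -> B y -> B (x * y)) ->
  forall b x, B b -> span_over B G x -> span_over B G (b * x).
Proof.
move=> BM b _ hb [m [b' [w [Bb Gw ->]]]]; exists m, (fun i => b * b' i), w.
split=> // [i|]; first exact: BM.
by rewrite mulr_sumr; apply: eq_bigr => i _; rewrite mulrA.
Qed.

Lemma span_over_gen x : B 1 -> G x -> span_over B G x.
Proof.
by move=> B1 Gx; exists 1%N, (fun=> 1), (fun=> x); split => //; rewrite big_ord1 mul1r.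
Qed.

End Span.

Section Normal.
Context (R : realType) (d n : nat) (M : set 'rV[rat]_d) (B : 'M[rat]_d).
Hypothesis B_basis : lattice_basis M B.

Lemma basisD u v : M u -> M v -> M (u + v).
Proof.
case: B_basis => _ MB /MB[z ->] /MB[z' ->]; apply/MB; exists (z + z').
by rewrite raddfD /= mulmxDl.
Qed.

Lemma basisN u : M u -> M (- u).
Proof.
case: B_basis => _ MB /MB[z ->]; apply/MB; exists (- z).
by rewrite raddfN /= mulNmx.
Qed.

Lemma basis0 : M 0.
Proof. by case: B_basis => _ MB; apply/MB; exists 0; rewrite raddf0 mul0mx. Qed.

Lemma basisB u v : M u -> M v -> M (u - v).
Proof. by move=> hu /basisN; apply: basisD. Qed.

Lemma basisMn u k : M u -> M (u *+ k).
Proof. by move=> hu; elim: k => [|k IHk]; [exact: basis0|rewrite mulrS; apply: basisD]. Qed.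

Lemma basis_sum (I : Type) (r : seq I) (F : I -> 'rV[rat]_d) :
  (forall i, M (F i)) -> M (\sum_(i <- r) F i).
Proof. by move=> h; elim/big_ind: _ => //; [exact: basis0|exact: basisD]. Qed.

Local Notation OZ := (@OZ R d n M).

Lemma OZ_mul x y : OZ x -> OZ y -> OZ (x * y).
Proof.
by move=> hx hy a /cvcoefM_neq0[b [e [-> /hx + /hy]]]; rewrite expoD; apply: basisD.
Qed.

Lemma OZ_const k : OZ (k%:A).
Proof.
move=> a; rewrite cvcoefZ cvcoef1; case: (a =P 0%MM) => [-> _|_].
  by rewrite expo0; apply: basis0.
by rewrite mulr0 eqxx.
Qed.

Lemma OZ1 : OZ 1.
Proof. by rewrite -(scale1r 1); apply: OZ_const. Qed.

Lemma OZ_div_mon a x : M (expo n a) -> OZ (mon a * x) -> OZ x.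
Proof.
move=> Ma hx b xb; have := hx (a + b)%MM; rewrite cvcoef_monMD => /(_ xb).
by rewrite expoD => /basisB /(_ Ma); rewrite addrC addKr.
Qed.

(* Projecting onto the exponents in M is linear over O_Z, so the projection of
   an inverse of x is again an inverse of x. *)
Lemma OZ_inv x : x \is a GRing.unit -> OZ x -> OZ x^-1.
Proof.
move=> ux hx; pose Q (a : 'X_{1..d}) := `[< M (expo n a) >].
suff -> : x^-1 = cvrestrict Q x^-1.
  move=> a; rewrite /= mulf_eq0 negb_or => /andP[+ _].
  by rewrite /Q; case: asboolP => // _; rewrite eqxx.
apply: (mulrI ux); rewrite mulrV //; apply/cvps_eqP => a.
transitivity ((Q a)%:R * (x * x^-1) a).
  rewrite mulrV // cvcoef1; case: eqP => [->|_]; last by rewrite mulr0.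
  by rewrite /Q expo0 (asboolT basis0) mulr1.
rewrite !cvcoefM mulr_sumr; apply: eq_bigr => b ba /=.
have [->|xb] := eqVneq (x b) 0; first by rewrite !mul0r mulr0.
suff -> : Q (a - b)%MM = Q a by rewrite mulrCA.
have Mb := hx _ xb; rewrite /Q -[in RHS](submK ba) expoD; congr asbool.
apply/propext; split=> [h|]; first exact: basisD.
by move=> /basisB/(_ Mb); rewrite addrK.
Qed.

End Normal.

Section FractionalMonomials.
Context (R : realType) (d n : nat).
Hypothesis n_gt0 : (0 < n)%N.

Lemma fracmon_sub (a b : 'X_{1..d}) :
  fracmon R n (expo n a - expo n b) = tofrac (mon a) / tofrac (mon b).
Proof.
rewrite /fracmon !mon_prod !rmorph_prod -prodfV -big_split; apply: eq_bigr => i _ /=.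
have n0 : n%:R != 0 :> rat by rewrite pnatr_eq0 -lt0n.
have -> : (expo n a - expo n b) 0 i *+ n = ((a i)%:Z - (b i)%:Z)%:~R.
  by rewrite !mxE -[(_ - _) *+ n]mulr_natr mulrBl !divfK // intrB.
rewrite numq_int !rmorphXn expfzDr; first by rewrite exprnN.
by rewrite tofrac_eq0 mon_neq0.
Qed.

End FractionalMonomials.

(** The Cauchy-Binet formula before the maps [t] with the same image are grouped. *)
Lemma det_mulmx_rowsub (A : comNzRingType) d m (C : 'M[A]_(d, m)) (N : 'M[A]_(m, d)) :
  \det (C *m N) = \sum_(t : {ffun 'I_d -> 'I_m})
     (\prod_i C i (t i)) * \det (rowsub t N).
Proof.
rewrite /determinant.
transitivity (\sum_(s : 'S_d) \sum_(t : {ffun 'I_d -> 'I_m})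
    (\prod_i C i (t i)) * ((-1) ^+ s * \prod_i N (t i) (s i))).
  apply: eq_bigr => s _; under eq_bigr do rewrite mxE.
  rewrite bigA_distr_bigA mulr_sumr; apply: eq_bigr => t _.
  by rewrite big_split mulrCA.
rewrite exchange_big; apply: eq_bigr => t _; rewrite mulr_sumr.
apply: eq_bigr => s _; congr (_ * (_ * _)).
by apply: eq_bigr => i _; rewrite mxE.
Qed.

(** * Logarithmic derivatives of differential forms *)

Section Differentials.
Context (R : realType) (d g : nat) (OS : comAlgType R[i]).
Local Notation m := (d + g)%N.
Context (pi : {lrmorphism cvps R m -> OS}) (nu : {lrmorphism OS -> cvps R d}).
Context (n : nat) (B : 'M[rat]_d) (eta1 : Omega1 pi -> 'rV[cvps R d]_d).
Hypothesis eta1_spec : log_map1 n nu B eta1.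
Local Notation u i := (nu (pi (mon U_(i)%MM))).

Definition log_matrix : 'M[cvps R d]_(m, d) := \matrix_(i, k) dlog n B k (u i).

Lemma pderiv_var (i j : 'I_m) : pderiv j (mon U_(i)%MM) = (i == j)%:R :> cvps R m.
Proof.
apply/cvps_eqP => a /=; have [->|ij] := eqVneq i j.
  rewrite cvcoef1 -{2}[U_(j)%MM]add0m eqm_add2r.
  by case: eqP => [->|_]; rewrite ?mulr0 // mnm0E mulr1.
case: eqP => [/mnmP/(_ j)|_]; last by rewrite mulr0.
by rewrite mnmDE !mnm1E eqxx (negbTE ij) addn1.
Qed.

Lemma eta1_mproj v :
  eta1 (mproj _ v) = (\row_i nu (v 0 i)) *m log_matrix.
Proof.
case: eta1_spec => eD eZ edK.
have e0 : eta1 0 = 0 by apply: (addrI (eta1 0)); rewrite -eD !addr0.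
have gradU i : grad pi (mon U_(i)%MM) = delta_mx 0 i.
  apply/rowP => j; rewrite !mxE eqxx /= pderiv_var eq_sym.
  by case: (j == i); rewrite ?rmorph1 ?rmorph0.
have -> : mproj _ v = \sum_i v 0 i *: dK pi (mon U_(i)%MM).
  rewrite {1}[v]row_sum_delta.
  have p0 : mproj [set grad pi F | F in [set F | pi F = 0]] 0 = 0.
    by apply: (addrI (mproj _ 0)); rewrite -mprojD !addr0.
  rewrite (big_morph _ (@mprojD _ _ _) p0); apply: eq_bigr => i _.
  by rewrite -mprojZ /dK gradU.
rewrite (big_morph _ eD e0) mulmx_sum_row; apply: eq_bigr => i _.
rewrite eZ edK mxE; congr (_ *: _).
by apply/rowP => k; rewrite !mxE.
Qed.

(** Row j is the image under [eta1] of the differential of [H j], expanded in the generators dU_i;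
    computed directly, it is the logarithmic derivative of 0. *)
Lemma jacobian_log_matrix (H : 'I_g -> cvps R m) :
  (forall j, pi (H j) = 0) ->
  (\matrix_(j < g, i < m) nu (pi (pderiv i (H j)))) *m log_matrix = 0.
Proof.
move=> H0; apply/row_matrixP => j; rewrite row_mul row0.
have -> : row j (\matrix_(j < g, i < m) nu (pi (pderiv i (H j))))
        = \row_i nu (grad pi (H j) 0 i) by apply/rowP => i; rewrite !mxE.
rewrite -eta1_mproj; case: eta1_spec => _ _ ->.
apply/rowP => k; rewrite !mxE H0 rmorph0; apply/cvps_eqP => a.
by rewrite /= mulr0.
Qed.

Context (etad : Omega pi d -> cvps R d).
Hypothesis etad_spec : log_map nu eta1 etad.

Lemma etad_minor (t : 'I_d -> 'I_m) :
  etad (wedge [ffun i => dK pi (mon U_(t i)%MM)]) = \det (rowsub t log_matrix).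
Proof.
case: eta1_spec => _ _ edK; case: etad_spec => _ _ ->; congr (\det _).
by apply/matrixP => i k; rewrite !mxE ffunE edK mxE.
Qed.

Lemma etad_wedge w : exists c : {ffun 'I_d -> 'I_m} -> OS,
  etad (wedge w) = \sum_t nu (c t) * \det (rowsub t log_matrix).
Proof.
case: etad_spec => _ _ ->.
have /fin_all_exists[v vE] i : exists v : 'rV[OS]_m, w i = mproj _ v.
  exact: mproj_surj.
exists (fun t : {ffun _} => \prod_i v i 0 (t i)).
pose C := \matrix_(i < d, l < m) nu (v i 0 l).
have -> : \matrix_(i < d, k < d) eta1 (w i) 0 k = C *m log_matrix.
  apply/row_matrixP => i; rewrite row_mul; apply/rowP => k.
  rewrite !mxE vE eta1_mproj !mxE; apply: eq_bigr => l _.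
  by rewrite !mxE.
rewrite det_mulmx_rowsub; apply: eq_bigr => t _; congr (_ * _).
by rewrite rmorph_prod; apply: eq_bigr => i _; rewrite mxE.
Qed.

Lemma etad_ind (Q : set (cvps R d)) :
  Q 0 -> (forall x y, Q x -> Q y -> Q (x + y)) ->
  (forall a x, Q x -> Q (nu a * x)) ->
  (forall t : 'I_d -> 'I_m, Q (\det (rowsub t log_matrix))) ->
  forall x, Q (etad x).
Proof.
move=> Q0 QD QM Qt x; case: (etad_spec) => eD eZ _.
have e0 : etad 0 = 0 by apply: (addrI (etad 0)); rewrite -eD !addr0.
have [v ->] := mproj_surj x; rewrite -(freeg_sumE v).
have p0 : mproj (@alternating_rel _ (Omega1 pi) d) 0 = 0.
  by apply: (addrI (mproj _ 0)); rewrite -mprojD !addr0.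
rewrite (big_morph _ (@mprojD _ _ _) p0) (big_morph _ eD e0).
elim/big_ind: _ => // w _.
have -> : << coeff w v *g w >> = coeff w v *: << w >> :> {freeg _ / _}.
  by apply/eqP/freeg_eqP => z; rewrite coeffZ !coeffU mul1r.
rewrite -mprojZ eZ; apply: (QM); have [c ->] := etad_wedge w.
by elim/big_ind: _ => // t _; apply: QM.
Qed.

End Differentials.

(** * Jacobian and logarithmic Jacobian ideals *)

Section LeadingExponents.
Context (d g n : nat) (lam : seq 'rV[rat]_d) (A : nat -> 'X_{1..d}).
Hypotheses (n_gt0 : (0 < n)%N)
  (lamE : forall j, (j < g)%N -> lam`_j = expo n (A j))
  (A_neq0 : forall j, (j < g)%N -> A j != 0%MM)
  (A_lt : forall j, (j.+1 < g)%N -> (A j <= A j.+1)%MM /\ A j != A j.+1).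

(* [lead_expo j] is n times lambda-bar_(j+1), the exponent of the leading monomial
   of U_(d+j+1) in the variables X_i^(1/n). *)
Fixpoint lead_expo (j : nat) : 'X_{1..d} :=
  if j is i.+1 then (lead_expo i *+ nidx lam i + (A i.+1 - A i))%MM else A 0.

Lemma lbarE j : (j < g)%N -> lbar lam j = expo n (lead_expo j).
Proof.
elim: j => [|j IHj] jg /=; first exact: lamE.
have [Aj _] := A_lt jg; rewrite expoD expo_mul -IHj ?(ltnW jg) // -addrA.
by rewrite (lamE jg) (lamE (ltnW jg)) -{1}(submK Aj) expoD addrK.
Qed.

(** The difference is that of two consecutive characteristic exponents; this makes the linear term
    in the next variable overweight. *)
Lemma lead_expo_lt j : (j.+1 < g)%N ->
  (lead_expo j *+ nidx lam j <= lead_expo j.+1)%MM /\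
  (lead_expo j *+ nidx lam j)%MM != lead_expo j.+1.
Proof.
move=> jg; have [Aj A_j] := A_lt jg; split; first by rewrite /= lem_addr // lepm_refl.
apply: contra A_j => /eqP; rewrite /= -{1}[(_ *+ _)%MM]addm0 => /addmI E.
by rewrite -(submK Aj) -E add0m.
Qed.

Lemma lead_expo_neq0 j : (j < g)%N -> lead_expo j != 0%MM.
Proof.
case: j => [|j] jg; first exact: A_neq0.
have [/mnm_lepP Lj L_j] := lead_expo_lt jg; apply: contraNneq L_j => L0.
apply/eqP; rewrite L0; apply/mnmP => i; apply/eqP; rewrite mnm0E -leqn0.
by have := Lj i; rewrite L0 mnm0E.
Qed.

Definition gen_expo (i : 'I_(d + g)) : 'X_{1..d} :=
  match split i with
  | inl i => (U_(i) *+ n)%MM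
  | inr j => lead_expo j
  end.

Lemma gen_expo_l i : gen_expo (lshift g i) = (U_(i) *+ n)%MM.
Proof. by rewrite /gen_expo -[lshift _ _]/(unsplit (inl i)) unsplitK. Qed.

Lemma gen_expo_r (j : 'I_g) : gen_expo (rshift d j) = lead_expo j.
Proof. by rewrite /gen_expo -[rshift _ _]/(unsplit (inr j)) unsplitK. Qed.

Lemma gen_expo_neq0 i : gen_expo i != 0%MM.
Proof.
case: (split_ordP i) => j ->; last by rewrite gen_expo_r lead_expo_neq0.
rewrite gen_expo_l; apply/eqP => /mnmP/(_ j).
by rewrite mulmnE mnm1E eqxx mnm0E mul1n => n0; have := n_gt0; rewrite n0.
Qed.

Lemma psiE (a : 'X_{1..d + g}) : psi lam a = expo n (mdot gen_expo a).
Proof.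
rewrite /psi /mdot expo_sum; apply: eq_bigr => i _; rewrite expo_mul.
case: (split_ordP i) => j ->; congr (_ *+ _).
  by rewrite gen_expo_l expo_unit // /gens -[lshift _ _]/(unsplit (inl j)) unsplitK.
by rewrite gen_expo_r -lbarE // /gens -[rshift _ _]/(unsplit (inr j)) unsplitK.
Qed.

(** Since [gamma0] may have negative coordinates, it is kept as a difference of exponents, which
    [fracmon_sub] turns into a quotient of monomials. *)
Lemma gamma0E : gamma0 g lam =
  expo n (\sum_(j < g) gen_expo (rshift d j) *+ (nidx lam j).-1)%MM
  - expo n (\sum_(i < d) U_(i) *+ n)%MM.
Proof.
rewrite /gamma0 !expo_sum; congr (_ - _).
  by apply: eq_bigr => j _; rewrite expo_mul gen_expo_r -lbarE.
apply/rowP => i; rewrite summxE (bigD1 i) //= big1 => [|l li].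
  by rewrite expo_unit // !mxE !eqxx addr0.
by rewrite expo_unit // mxE eq_sym (negbTE li) andbF.
Qed.

Lemma lead_expo_lattice (B : 'M[rat]_d) : lattice_basis (lattice lam g) B ->
  forall j, (j < g)%N -> lattice lam g (expo n (lead_expo j)).
Proof.
move=> hB; elim=> [|j IHj] jg; rewrite -lbarE //=; first exact: lattice_lam.
rewrite lbarE ?(ltnW jg) //; apply: (basisB hB); last exact/lattice_lam/ltnW.
by apply: (basisD hB); [apply/(basisMn hB)/IHj/ltnW|exact: lattice_lam].
Qed.

(** * The equations of a fiber as an overweight system *)

Section Fiber.
Context (R : realType) (ell : 'I_g -> 'X_{1..d + g}).
Hypothesis ell_rel : forall j : 'I_g, semigroup_relation lam j (ell j).
Context (c : 'I_g -> R[i]) (ca : 'I_g -> 'X_{1..d + g} -> R[i]).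
Hypothesis H_overweight : overweight lam c ca.
Context (p : 'rV[rat]_d -> R[i]).
Hypothesis nn_gt0 : forall j, (j < g)%N -> (0 < nidx lam j)%N.
Local Notation H := (fiber_coefs lam ell c ca p).
Local Notation pow j := (U_(rshift d j) *+ nidx lam j)%MM.
Local Notation L j := (gen_expo (rshift d j) *+ nidx lam j)%MM.

Lemma ell_suppE (j : 'I_g) (i : 'I_(d + g)) : (d + j <= i)%N -> ell j i = 0%N.
Proof. by case: (ell_rel j) => + _ _; apply. Qed.

Lemma ell_dotE j : mdot gen_expo (ell j) = L j.
Proof.
case: (ell_rel j) => _ _; rewrite psiE lbarE // -expo_mul => /(expo_inj n_gt0) <-.
by rewrite gen_expo_r.
Qed.

Lemma nextvarE (j : 'I_g) : c j != 0 ->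
  exists2 j' : 'I_g, nat_of_ord j' = j.+1 & nextvar d j = U_(rshift d j')%MM.
Proof.
case: H_overweight => [cE _]; rewrite cE => jg.
have j'g : (j.+1 < g)%N by rewrite ltn_neqAle jg ltn_ord.
exists (Ordinal j'g) => //; apply/mnmP => i; rewrite mnmE mnm1E -val_eqE /=.
by rewrite eq_sym.
Qed.

Lemma fiber_over j a : a != ell j -> a != pow j -> H j a != 0 ->
  (L j <= mdot gen_expo a)%MM /\ L j != mdot gen_expo a.
Proof.
move=> ae ap; rewrite /fiber_coefs (negbTE ae) (negbTE ap) subrr add0r.
have [->|ca0 _] := eqVneq (ca j a) 0; last first.
  have [_ /(_ _ _ ca0)[_]] := H_overweight.
  by rewrite psiE lbarE // -expo_mul gen_expo_r => /(prec_expo n_gt0).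
rewrite mul0r addr0 !mulf_eq0 !negb_or => /andP[/andP[/nextvarE[j' j'E ->] _]].
case: (a =P U_(rshift d j')%MM) => [-> _|_ /eqP//]; rewrite -[U_(_)%MM]mulm1n mdot_var mulm1n.
by rewrite !gen_expo_r j'E; apply: lead_expo_lt; rewrite -j'E.
Qed.

(** Comparing exponents excludes that a deformation term coincides with a monomial of the binomial
    and alters its coefficient. *)
Lemma fiber_eq j a : mdot gen_expo a = L j ->
  H j a = (a == ell j)%:R - (a == pow j)%:R.
Proof.
move=> aL; rewrite /fiber_coefs.
have [->|ca0] := eqVneq (ca j a) 0; last first.
  have [_ /(_ _ _ ca0)[_]] := H_overweight.
  rewrite psiE lbarE // -expo_mul aL gen_expo_r => /(prec_expo n_gt0)[_].
  by rewrite eqxx.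
rewrite mul0r addr0; have [->|/nextvarE[j' j'E E]] := eqVneq (c j) 0.
  by rewrite !mul0r addr0.
rewrite E; case: (a =P U_(rshift d j')%MM) => [aE|_]; last by rewrite mulr0 addr0.
have [_ /negP[]] : (L j <= mdot gen_expo a)%MM /\ L j != mdot gen_expo a.
  rewrite aE -[U_(_)%MM]mulm1n mdot_var mulm1n !gen_expo_r j'E.
  by apply: lead_expo_lt; rewrite -j'E.
by rewrite aL.
Qed.

Lemma ell_pow_neq j : ell j != pow j.
Proof.
apply/eqP => /mnmP/(_ (rshift d j)); rewrite ell_suppE // mulmnE mnm1E eqxx mul1n.
by move=> n0; have := nn_gt0 (ltn_ord j); rewrite -n0.
Qed.

Lemma fiber_ell j : H j (ell j) = 1.
Proof. by rewrite fiber_eq ?ell_dotE // eqxx (negbTE (ell_pow_neq j)) subr0. Qed.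

Lemma fiber_pow j : H j (pow j) = -1.
Proof. by rewrite fiber_eq ?mdot_var // eqxx eq_sym (negbTE (ell_pow_neq j)) sub0r. Qed.

End Fiber.
End LeadingExponents.

(** * Comparison of the two ideals *)

Section Main.
Context (R : realType) (d n g : nat).
Context (f : {poly cvps R d}) (lam : g.-tuple 'rV[rat]_d).
Hypotheses (f_weierstrass : weierstrass n f) (f_irreducible : irreducible f).
Hypothesis lam_char : char_exponents n f lam.
Context (ell : 'I_g -> 'X_{1..d + g}).
Hypothesis ell_rel : forall j : 'I_g, semigroup_relation lam j (ell j).
Context (c : 'I_g -> R[i]) (ca : 'I_g -> 'X_{1..d + g} -> R[i]).
Hypothesis H_overweight : overweight lam c ca.
Context (p : 'rV[rat]_d -> R[i]).
Hypothesis H_convergent : forall j : 'I_g, convergent (fiber_coefs lam ell c ca p j).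
Local Notation H := (fun j : 'I_g => Cvps (H_convergent j)).
Context (OS : comAlgType R[i]) (pi : {lrmorphism cvps R (d + g) -> OS}).
Hypothesis OS_local_ring : local_ring_of pi H.
Context (nu : {lrmorphism OS -> cvps R d}).
Hypothesis nu_normalization : normalization n (lattice lam g) pi nu.
Context (B : 'M[rat]_d).
Hypothesis B_basis : lattice_basis (lattice lam g) B.
Context (eta1 : Omega1 pi -> 'rV[cvps R d]_d) (etad : Omega pi d -> cvps R d).
Hypotheses (eta1_spec : log_map1 n nu B eta1) (etad_spec : log_map nu eta1 etad).

Local Notation M := (lattice lam g).
Local Notation N := (log_matrix pi nu n B).

Definition jac_matrix : 'M[cvps R d]_(g, d + g) :=
  \matrix_(j, i) nu (pi (pderiv i (H j))).
Local Notation J := jac_matrix.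

Lemma n_gt0 : (0 < n)%N.
Proof. exact: weierstrass_deg_gt0 f_weierstrass f_irreducible. Qed.

Lemma pi_H j : pi (H j) = 0.
Proof.
by have [_ piE] := OS_local_ring; apply/piE; apply: span_over_gen => //.
Qed.

(** The fraction x / 1 is integral over the local ring, so it comes from O_Z, and the embedding into
    the fraction field is injective. *)
Lemma nu_OZ x : OZ n M (nu x).
Proof.
have [_ _ nuE] := nu_normalization.
pose psi : {rmorphism OS -> {fraction cvps R d}} := @tofrac (cvps R d) \o nu.
have [z hz /eqP] : exists2 z, OZ n M z & tofrac (nu x) = tofrac z.
  apply/nuE; split; last exact: (integral_id psi x).
  by exists x, 1; rewrite oner_neq0 rmorph1 divr1.
by rewrite tofrac_eq => /eqP->.
Qed.

Lemma exponents_ex : exists A : nat -> 'X_{1..d},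
  [/\ forall j, (j < g)%N -> lam`_j = expo n (A j),
      forall j, (j < g)%N -> A j != 0%MM
    & forall j, (j.+1 < g)%N -> (A j <= A j.+1)%MM /\ A j != A j.+1].
Proof.
case: lam_char => lam_sorted lamP.
have /choice[A AP] (j : nat) : exists a : 'X_{1..d},
    (j < g)%N -> a != 0%MM /\ lam`_j = expo n a.
  have [jg|gj] := ltnP j g; last by exists 0%MM.
  have /lamP/(char_exponent_expo f_weierstrass)[a a0 lamE] : lam`_j \in val lam.
    by rewrite mem_nth ?size_tuple.
  by exists a.
exists A; split=> j jg; [by have [] := AP _ jg|by have [] := AP _ jg|].
move/(sortedP 0): lam_sorted => /(_ j); rewrite size_tuple => /(_ jg).
by have [_ ->] := AP _ jg; have [_ ->] := AP _ (ltnW jg); exact: (prec_expo n_gt0).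
Qed.

Lemma nu_jac_minor (s : 'I_g -> 'I_(d + g)) :
  nu (pi (\det (\matrix_(j < g, k < g) pderiv (s k) (H j)))) = \det (colsub s J).
Proof.
rewrite -!det_map_mx; congr (\det _).
by apply/matrixP => j k; rewrite !mxE.
Qed.

(** For i <= d, [u_i] is X_i, so row i is X_i times the coordinates of e_i in the basis [B], that
    is, row i of [invmx B]. *)
Lemma log_matrix_det :
  \det (usubmx N) = mon (\sum_(i < d) U_(i) *+ n)%MM * (ratr (\det (invmx B)))%:A.
Proof.
have [_ nuU _] := nu_normalization.
have -> : usubmx N = diag_mx (\row_i mon (U_(i) *+ n)%MM)
    *m map_mx (fun q => (ratr q)%:A) (invmx B).
  apply/matrixP => i k; rewrite mul_diag_mx !mxE nuU mulr_algr.
  apply/cvps_eqP => a /=; case: (a =P (U_(i) *+ n)%MM) => [->|_]; last by rewrite !mulr0.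
  rewrite !mulr1 (expo_unit n_gt0) -rowE; congr (ratr _).
  by rewrite mxE.
rewrite det_mulmx det_diag mon_sum; congr (_ * _).
  by apply: eq_bigr => i _; rewrite mxE.
exact: (det_map_mx (GRing.in_alg (cvps R d) \o ratr) (invmx B)).
Qed.

(* The columns s (rshift d k) of J are complementary to the rows s (lshift g k)
   of N. *)
Lemma jac_minor_fracmon : exists2 V : cvps R d, V \is a GRing.unit /\ OZ n M V &
  forall s : {perm 'I_(d + g)},
    tofrac (\det (colsub (fun k => s (rshift d k)) J)) =
    fracmon R n (gamma0 g lam) *
    tofrac ((-1) ^+ s * V * \det (rowsub (fun k => s (lshift g k)) N)).
Proof.
have [A [lamE A_neq0 A_lt]] := exponents_ex.
have nn_gt0 j : (j < g)%N -> (0 < nidx lam j)%N.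
  by move=> jg; apply: (nidx_gt0 n_gt0 (lamE _ jg)).
pose Gam := @gen_expo d g n lam A.
pose phi : {lrmorphism cvps R (d + g) -> cvps R d} := nu \o pi.
have [V0 uV0 detJ] : exists2 V : cvps R d, V \is a GRing.unit &
    \det (rsubmx J) = mon (\sum_(j < g) Gam (rshift d j) *+ (nidx lam j).-1)%MM * V.
  have [|||||||||V uV VE] := @lead_jacobian R d g phi Gam (fun j => nidx lam j) ell H.
  - exact: (gen_expo_neq0 _ n_gt0 A_neq0 A_lt).
  - by move=> j; apply: nn_gt0.
  - exact: (ell_suppE ell_rel).
  - exact: (ell_dotE n_gt0 lamE A_lt ell_rel).
  - exact: (fiber_ell n_gt0 lamE A_lt ell_rel H_overweight p nn_gt0).
  - exact: (fiber_pow n_gt0 lamE A_lt ell_rel H_overweight p nn_gt0).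
  - exact: (fiber_over n_gt0 lamE A_lt H_overweight).
  - by move=> i; have [_ nuU _] := nu_normalization; rewrite /= nuU /Gam gen_expo_l.
  - by move=> j; rewrite /= pi_H rmorph0.
  exists V => //; rewrite -VE; congr (\det _).
  by apply/matrixP => j k; rewrite !mxE.
pose q : cvps R d := (ratr (\det (invmx B)))%:A.
have uq : q \is a GRing.unit.
  rewrite unit_coef0 /= eqxx mulr1 fmorph_eq0 -unitfE -unitmxE unitmx_inv.
  by case: B_basis.
have Vq : V0 / q \is a GRing.unit by rewrite unitrM uV0 unitrV.
exists (V0 / q) => [|s]; first split=> //.
  (* The minor is the image of an element of the local ring and its leading exponent lies in the
     lattice, so [V0] is in O_Z; [q] is an invertible constant. *)
  apply: (OZ_mul B_basis); last by apply: (OZ_inv B_basis) => //; apply: OZ_const B_basis _.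
  apply: (OZ_div_mon B_basis (a := (\sum_(j < g) Gam (rshift d j) *+ (nidx lam j).-1)%MM)).
    rewrite expo_sum; apply: (basis_sum B_basis) => j; rewrite expo_mul.
    apply: (basisMn B_basis); rewrite /Gam gen_expo_r.
    exact: lead_expo_lattice B_basis _ _.
  rewrite -detJ (_ : \det _ = nu (\det (\matrix_(j < g, k < g) pi (pderiv (rshift d k) (H j))))).
    exact: nu_OZ.
  rewrite -det_map_mx; congr (\det _).
  by apply/matrixP => j k; rewrite !mxE.
have JN : J *m N = 0 by apply: jacobian_log_matrix eta1_spec _ pi_H.
have := complementary_minors JN s; rewrite log_matrix_det detJ -/q.
set mJ := \det _; set mN := \det _; set a := mon _; set b := mon _ => E.
rewrite (gamma0E n_gt0 lamE A_lt) fracmon_sub ?n_gt0 // -/Gam -/a -/b.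
have a0 : tofrac a != 0 :> {fraction cvps R d} by rewrite tofrac_eq0 mon_neq0.
have q0 : tofrac q != 0 :> {fraction cvps R d}.
  by rewrite tofrac_eq0; apply: contraTneq uq => ->; rewrite unitr0.
apply: (mulIf (mulf_neq0 a0 q0)); rewrite mulrACA divfK // -!rmorphM E.
rewrite -{1}(divrK uq V0); move: (V0 / q) => W.
by rewrite (mulrCA mN) (mulrCA _ b) -!mulrA (mulrCA W).
Qed.

Lemma jacobian_log_jacobian :
  [set tofrac x | x in Jac_ext n M pi nu H]
  = [set fracmon R n (gamma0 g lam) * tofrac x | x in Jlog n M etad].
Proof.
have [V [uV hV] VE] := jac_minor_fracmon.
have OZM (x y : cvps R d) : OZ n M x -> OZ n M y -> OZ n M (x * y).
  exact: (OZ_mul B_basis).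
have hsign (s : {perm 'I_(d + g)}) (W : cvps R d) : OZ n M W -> OZ n M ((-1) ^+ s * W).
  move=> hW; apply: (OZM) => //; rewrite (_ : (-1) ^+ s = ((-1) ^+ s)%:A :> cvps R d).
    exact: OZ_const B_basis _.
  by case: (odd_perm s); rewrite ?expr0 ?expr1 ?scaleN1r ?scale1r.
apply/seteqP; split=> _ [x hx <-].
- suff [x' hx' ->] : exists2 x', Jlog n M etad x' &
      tofrac x = fracmon R n (gamma0 g lam) * tofrac x' by exists x'.
  (* Two nested spans are unfolded: over O_Z here, then over the local ring, whose elements act
     through [nu] and land in O_Z. *)
  move: x hx; apply: span_over_ind => [|x y|b x|_ [x + <-]].
  + by exists 0; [exact: span_over0|rewrite !rmorph0 mulr0].
  + move=> [x' hx' xE] [y' hy' yE]; exists (x' + y'); first exact: span_overD.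
    by rewrite !rmorphD /= xE yE mulrDr.
  + move=> hb [x' hx' xE]; exists (b * x'); first exact: span_overM.
    by rewrite !rmorphM /= xE mulrCA.
  move: x; apply: span_over_ind => [|x y|b x _|_ [s s_incr <-]].
  + by exists 0; [exact: span_over0|rewrite !rmorph0 mulr0].
  + move=> [x' hx' xE] [y' hy' yE]; exists (x' + y'); first exact: span_overD.
    by rewrite !rmorphD /= xE yE mulrDr.
  + move=> [x' hx' xE]; exists (nu b * x'); first exact: (span_overM OZM (@nu_OZ b) hx').
    by rewrite !rmorphM /= xE mulrCA.
  rewrite nu_jac_minor.
  have [t t_incr st] := increasing_complement (addnC d g) (increasing_inj s_incr).
  have [|sg [sgl sgr]] := perm_of_split (increasing_inj t_incr) (increasing_inj s_incr).
    by move=> i j; rewrite eq_sym.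
  exists ((-1) ^+ sg * V * \det (rowsub t N)).
    apply: span_overM => //; first exact: hsign.
    apply: span_over_gen; first exact: OZ1 B_basis.
    exists (wedge [ffun i => dK pi (mon U_(t i)%MM)]) => //.
    exact: (etad_minor eta1_spec etad_spec).
  rewrite (_ : t = (fun k => sg (lshift g k))); last by apply/funext => k; rewrite sgl.
  by rewrite -VE; congr (tofrac (\det (colsub _ _))); apply/funext => k; rewrite sgr.
suff [y hy <-] : exists2 y, Jac_ext n M pi nu H y &
    tofrac y = fracmon R n (gamma0 g lam) * tofrac x by exists y.
move: x hx; apply: span_over_ind => [|x y|b x|_ [x _ <-]].
- by exists 0; [exact: span_over0|rewrite !rmorph0 mulr0].
- move=> [x' hx' xE] [y' hy' yE]; exists (x' + y'); first exact: span_overD.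
  by rewrite !rmorphD /= xE yE mulrDr.
- move=> hb [x' hx' xE]; exists (b * x'); first exact: span_overM.
  by rewrite !rmorphM /= xE mulrCA.
pose Q (z : cvps R d) := exists2 y, Jac_ext n M pi nu H y &
    tofrac y = fracmon R n (gamma0 g lam) * tofrac z.
apply: (@etad_ind _ _ _ _ _ _ _ _ _ eta1_spec _ etad_spec Q) => [|x1 y|b x1|t].
- by exists 0; [exact: span_over0|rewrite !rmorph0 mulr0].
- move=> [x' hx' xE] [y' hy' yE]; exists (x' + y'); first exact: span_overD.
  by rewrite !rmorphD /= xE yE mulrDr.
- move=> [x' hx' xE]; exists (nu b * x'); first exact: (span_overM OZM (@nu_OZ b) hx').
  by rewrite !rmorphM /= xE mulrCA.
(* Tuples of differentials may repeat a variable; the minor then has two equal rows and vanishes. *)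
have [t_inj|t_ninj] := pselect (injective t); last first.
  have [i [j [ij tij]]] : exists i j, i != j /\ t i = t j.
    apply: contrapT => nt; apply: t_ninj => i j tij.
    by apply/eqP/negPn/negP => ij; apply: nt; exists i, j.
  exists 0; first exact: span_over0.
  rewrite (determinant_alternate ij) ?rmorph0 ?mulr0 // => k.
  by rewrite !mxE tij.
(* Only the complementary columns must be increasing, to give a generator of the Jacobian ideal; the
   order of [t] is absorbed in the sign of [sg]. *)
have [s s_incr ts] := increasing_complement (erefl (d + g)%N) t_inj.
have [sg [sgl sgr]] := perm_of_split t_inj (increasing_inj s_incr) ts.
(* By [VE] the minor of [J] is X^(gamma_0) [W] times that of [N], so it is divided by [W], whose
   inverse stays in O_Z. *)
pose W := (-1) ^+ sg * V.
have uW : W \is a GRing.unit by rewrite unitrM uV rpredX ?rpredN ?rpred1.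
exists (W^-1 * \det (colsub s J)).
  apply: span_overM => //; first by apply: (OZ_inv B_basis) => //; apply: hsign.
  apply: span_over_gen; first exact: OZ1 B_basis.
  exists (pi (\det (\matrix_(j < g, k < g) pderiv (s k) (H j)))).
    by apply: span_over_gen => //; exists s.
  exact: nu_jac_minor.
rewrite (_ : s = (fun k => sg (rshift d k))); last by apply/funext => k; rewrite sgr.
rewrite (_ : t = (fun k => sg (lshift g k))); last by apply/funext => k; rewrite sgl.
rewrite rmorphM /= VE mulrCA -rmorphM -/W; congr (_ * tofrac _).
by rewrite mulKr.
Qed.

End Main.

Theorem corollary4p15
  (R : realType) (n g : nat)
  (f : {poly cvps R 2}) (lam : g.-tuple 'rV[rat]_2)
  (f_weierstrass : weierstrass n f)
  (f_quasi_ordinary : quasi_ordinary f)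
  (f_irreducible : irreducible f)
  (lam_char : char_exponents n f lam)
  (ell : 'I_g -> 'X_{1..2 + g})
  (ell_rel : forall j : 'I_g, semigroup_relation lam j (ell j))
  (c : 'I_g -> R[i]) (ca : 'I_g -> 'X_{1..2 + g} -> R[i])
  (H_overweight : overweight lam c ca)
  (p : 'rV[rat]_2 -> R[i])
  (p_torus : torus_point (lattice lam g) p)
  (H_convergent : forall j : 'I_g, convergent (fiber_coefs lam ell c ca p j))
  (OS : comAlgType R[i]) (pi : {lrmorphism cvps R (2 + g) -> OS})
  (OS_local_ring : local_ring_of pi (fun j : 'I_g => Cvps (H_convergent j)))
  (nu : {lrmorphism OS -> cvps R 2})
  (nu_normalization : normalization n (lattice lam g) pi nu)
  (B : 'M[rat]_2) (B_basis : lattice_basis (lattice lam g) B)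
  (eta1 : Omega1 pi -> 'rV[cvps R 2]_2) (eta1_spec : log_map1 n nu B eta1)
  (eta2 : Omega pi 2 -> cvps R 2) (eta2_spec : log_map nu eta1 eta2) :
  [set tofrac x | x in
     Jac_ext n (lattice lam g) pi nu (fun j : 'I_g => Cvps (H_convergent j))]
  = [set fracmon R n (gamma0 g lam) * tofrac x | x in
     Jlog n (lattice lam g) eta2].
Proof.
exact: (jacobian_log_jacobian f_weierstrass f_irreducible lam_char ell_rel H_overweight
          OS_local_ring nu_normalization B_basis eta1_spec eta2_spec).
Qed.
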